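(* Let $Q$ be a well-quasi-ordered set with ordering $\preceq$, let $k$ be a constant and let $\mathbb{F}$ be a finite field. Let $N_1,N_2,\ldots$ be an infinite sequence of $Q$-labeled Lagrangian chain-groups over $\mathbb{F}$ having branch-width at most $k$. Then there exist $i<j$ such that $N_i$ is simply isomorphic to a $Q$-minor of $N_j$.
   Context: Let $\mathbb{F}$ be a field and $K=\mathbb{F}^2$, equipped with a bilinear form $\langle\,,\,\rangle_K$ that is either $b^+(\binom ab,\binom cd)=ad+bc$ (symmetric) or $b^-(\binom ab,\binom cd)=ad-bc$ (skew-symmetric). For a finite set $V$, a chain on $V$ to $K$ is a map $f:V\to K$; chains form a vector space $K^V$ with bilinear form $\langle f,g\rangle=\sum_{x\in V}\langle f(x),g(x)\rangle_K$. A chain-group on $V$ to $K$ (over $\mathbb{F}$) is a subspace $N$ of $K^V$; it is isotropic if $\langle f,g\rangle=0$ for all $f,g\in N$, and Lagrangian if it is isotropic and $\dim N=|V|$. For $T\subseteq V$ and a chain $f$, $f\cdot T$ is the restriction of $f$ to $T$; $N\times T=\{f\cdot T: f\in N,\ f(x)=0\ \forall x\in V\setminus T\}$. Deletion: $N\setminus T=\{f\cdot(V\setminus T): f\in N,\ \langle f(x),\binom10\rangle_K=0\ \forall x\in T\}$; contraction: $N/T=\{f\cdot(V\setminus T): f\in N,\ \langle f(x),\binom01\rangle_K=0\ \forall x\in T\}$. A minor of $N$ is a chain-group $N/X\setminus Y$ on $V\setminus(X\cup Y)$ for disjoint $X,Y\subseteq V$. A simple isomorphism from a chain-group $N$ on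 $V$ to a chain-group $N'$ on $V'$ (both using the same type of form on $K$) is a bijection $\mu:V\to V'$ with $N=\{f\circ\mu: f\in N'\}$. The connectivity function is $\lambda_N(U)=\frac12(\dim N-\dim(N\times(V\setminus U))-\dim(N\times U))$. A branch-decomposition of $N$ is a pair $(T,\mathcal L)$ of a tree $T$ with maximum degree at most $3$ and a bijection $\mathcal L$ from $V$ to the leaves of $T$; the width of an edge $e$ whose removal splits the leaves into $(X_e,Y_e)$ is $\lambda_N(\mathcal L^{-1}(X_e))$, the width of the decomposition is the maximum edge width, and the branch-width of $N$ is the minimum width over all branch-decompositions ($0$ if $|V|\le1$). A $Q$-labeling of $N$ is a map $\mu:V\to Q$; a $Q$-labeled chain-group $N'$ on $V'$ with labeling $\mu'$ is a $Q$-minor of a $Q$-labeled chain-group $N$ with labeling $\mu$ if $N'$ is a minor of $N$ and $\mu'(v)\preceq\mu(v)$ for all $v\in V'$; ''simply isomorphic to a $Q$-minor'' means there is a simple isomorphism onto a $Q$-minor that is compatible with the labels in this sense. *)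

(* Defs.v *)
From HB Require Import structures.
From mathcomp Require Import all_boot all_order all_algebra.

Set Implicit Arguments.
Unset Strict Implicit.
Unset Printing Implicit Defensive.

Import Order.TTheory GRing.Theory Num.Theory.
Local Open Scope ring_scope.

Variant form_type := Symmetric | SkewSymmetric.

Definition formK (F : fieldType) (s : form_type) (u v : 'cV[F]_2) : F :=
  match s with
  | Symmetric => u 0 0 * v 1 0 + u 1 0 * v 0 0
  | SkewSymmetric => u 0 0 * v 1 0 - u 1 0 * v 0 0
  end.

Definition e10 (F : fieldType) : 'cV[F]_2 := \col_i (i == 0)%:R.
Definition e01 (F : fieldType) : 'cV[F]_2 := \col_i (i == 1)%:R.
Arguments e10 {F}.
Arguments e01 {F}.

Notation chain F V := {ffun V -> 'cV[F]_2}.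

Definition chain_form (F : fieldType) (s : form_type) (V : finType)
    (f g : chain F V) : F := \sum_(x : V) formK s (f x) (g x).

(* A subset T of V becomes the ground set {x : V | x \in T}. *)
Definition restr (F : fieldType) (V : finType) (T : {set V}) (f : chain F V) :
  chain F {x : V | x \in T} := [ffun x => f (val x)].

Lemma restr_is_linear (F : fieldType) (V : finType) (T : {set V}) : linear (@restr F V T).
Proof. by move=> a f g; apply/ffunP => x; rewrite !ffunE. Qed.

HB.instance Definition _ (F : fieldType) (V : finType) (T : {set V}) :=
  GRing.isLinear.Build F (chain F V) (chain F {x : V | x \in T}) _
    (@restr F V T) (@restr_is_linear F V T).

Definition chain_eval (F : fieldType) (V : finType) (x : V) (f : chain F V) :
  'cV[F]_2 := f x.

Lemma chain_eval_is_linear (F : fieldType) (V : finType) (x : V) : linear (@chain_eval F V x).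
Proof. by move=> a f g; rewrite /chain_eval !ffunE. Qed.

HB.instance Definition _ (F : fieldType) (V : finType) (x : V) :=
  GRing.isLinear.Build F (chain F V) 'cV[F]_2 _
    (@chain_eval F V x) (@chain_eval_is_linear F V x).

Definition chain_pair (F : fieldType) (s : form_type) (V : finType)
  (x : V) (e : 'cV[F]_2) (f : chain F V) : F^o := formK s (f x) e.

Lemma chain_pair_is_linear (F : fieldType) (s : form_type) (V : finType)
    (x : V) (e : 'cV[F]_2) : linear (@chain_pair F s V x e).
Proof.
move=> a f g; rewrite /chain_pair /formK !ffunE !mxE.
by case: s; rewrite !mulrDl -!mulrA scalerDr ?scalerN ?opprD addrACA.
Qed.

HB.instance Definition _ (F : fieldType) (s : form_type) (V : finType)
    (x : V) (e : 'cV[F]_2) :=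
  GRing.isLinear.Build F (chain F V) F^o _
    (@chain_pair F s V x e) (@chain_pair_is_linear F s V x e).

Record chain_group (F : fieldType) := ChainGroup {
  cg_form : form_type;
  cg_ground : finType;
  cg_space : {vspace chain F cg_ground}
}.

Definition isotropic (F : fieldType) (N : chain_group F) : Prop :=
  forall f g, f \in cg_space N -> g \in cg_space N ->
    chain_form (cg_form N) f g = 0.

Definition Lagrangian (F : fieldType) (N : chain_group F) : Prop :=
  isotropic N /\ \dim (cg_space N) = #|cg_ground N|.

(* N x T = { f.T : f in N, f = 0 outside T } *)
Definition cross (F : fieldType) (N : chain_group F)
    (T : {set cg_ground N}) :
    {vspace chain F {x : cg_ground N | x \in T}} :=
  (linfun (@restr F _ T) @:
    (cg_space N :&:
     \bigcap_(x in ~: T) lker (linfun (@chain_eval F (cg_ground N) x))))%VS.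

(* { f.(V \ T) : f in N, <f(x), e> = 0 for all x in T } *)
Definition reduce (F : fieldType) (e : 'cV[F]_2) (N : chain_group F)
    (T : {set cg_ground N}) : chain_group F :=
  @ChainGroup F (cg_form N) {x : cg_ground N | x \in ~: T}
    (linfun (@restr F _ (~: T)) @:
      (cg_space N :&:
       \bigcap_(x in T)
         lker (linfun (@chain_pair F (cg_form N) (cg_ground N) x e))))%VS.

Definition deletion (F : fieldType) (N : chain_group F)
    (T : {set cg_ground N}) : chain_group F := reduce e10 T.
Definition contraction (F : fieldType) (N : chain_group F)
    (T : {set cg_ground N}) : chain_group F :=
  reduce e01 T.

(* N / X \ Y, for Y disjoint from X; the preimage views Y as a subset of the
   ground set V \ X of N / X. *)
Definition minor (F : fieldType) (N : chain_group F)
    (X Y : {set cg_ground N}) : chain_group F :=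
  @deletion F (@contraction F N X)
    [set v : {x : cg_ground N | x \in ~: X} | val v \in Y].

Definition minor_val (F : fieldType) (N : chain_group F)
    (X Y : {set cg_ground N}) (v : cg_ground (minor X Y)) :
  cg_ground N := val (val v).

Lemma mem_cross (F : fieldType) (N : chain_group F)
    (T : {set cg_ground N}) g :
  g \in cross T <->
  exists f, [/\ f \in cg_space N, forall x, x \notin T -> f x = 0
              & g = restr T f].
Proof.
split=> [/memv_imgP[f]|[f [Nf f0 ->]]].
  rewrite memv_cap lfunE => /andP[Nf /subv_bigcapP f0] ->.
  exists f; split=> // x xT; have := f0 x; rewrite inE xT => /(_ isT).
  by rewrite -memvE memv_ker lfunE => /eqP.
rewrite -(lfunE (@restr F _ T)) memv_img// memv_cap Nf memvE.
apply/subv_bigcapP => x; rewrite inE => xT.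
by rewrite -memvE memv_ker lfunE /= /chain_eval f0.
Qed.

Lemma mem_reduce (F : fieldType) (e : 'cV[F]_2) (N : chain_group F)
    (T : {set cg_ground N}) g :
  g \in cg_space (reduce e T) <->
  exists f, [/\ f \in cg_space N,
                forall x, x \in T -> formK (cg_form N) (f x) e = 0
              & g = restr (~: T) f].
Proof.
split=> [/memv_imgP[f]|[f [Nf f0 ->]]].
  rewrite memv_cap lfunE => /andP[Nf /subv_bigcapP f0] ->.
  exists f; split=> // x xT; have := f0 x xT.
  by rewrite -memvE memv_ker lfunE => /eqP.
rewrite -(lfunE (@restr F _ (~: T))) memv_img// memv_cap Nf memvE.
apply/subv_bigcapP => x xT.
by rewrite -memvE memv_ker lfunE /= /chain_pair f0.
Qed.

Definition simple_isomorphism (F : fieldType) (N N' : chain_group F)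
    (mu : cg_ground N -> cg_ground N') : Prop :=
  [/\ cg_form N = cg_form N', bijective mu
    & forall g : chain F (cg_ground N),
        g \in cg_space N <->
        exists2 f, f \in cg_space N' & g = [ffun x => f (mu x)]].

(* Rational-valued: the numerator can be odd for a general chain-group. *)
Definition connectivity (F : fieldType) (N : chain_group F)
    (U : {set cg_ground N}) : rat :=
  ((\dim (cg_space N))%:R - (\dim (cross (~: U)))%:R - (\dim (cross U))%:R) / 2.

Definition is_tree (T : finType) (e : rel T) : Prop :=
  [/\ (0 < #|T|)%N, symmetric e, irreflexive e, (forall x y, connect e x y)
    & forall c : seq T, ucycle e c -> (size c <= 2)%N].

Definition degree (T : finType) (e : rel T) (x : T) : nat := #|[set y | e x y]|.

Definition leaf (T : finType) (e : rel T) : pred T :=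
  fun x => degree e x == 1%N.

Definition remove_edge (T : finType) (e : rel T) (x y : T) : rel T :=
  fun a b =>
    [&& e a b, (a, b) != (x, y) & (a, b) != (y, x)].

Record branch_decomposition (V : finType) := BranchDecomposition {
  bd_vertex : finType;
  bd_adj : rel bd_vertex;
  bd_leaf : V -> {t : bd_vertex | leaf bd_adj t};
  bd_tree : is_tree bd_adj;
  bd_subcubic : forall t, (degree bd_adj t <= 3)%N;
  bd_leaf_bij : bijective bd_leaf
}.

(* The elements whose leaf lies on the side of t when the edge tt' is removed. *)
Definition bd_side (V : finType) (D : branch_decomposition V)
    (t t' : bd_vertex D) : {set V} :=
  [set v | connect (remove_edge (@bd_adj _ D) t t') t (val (bd_leaf D v))].

(* The maximum is over edges taken in both orientations, on which [connectivity]
   agrees; starting it from 0 is harmless as [connectivity] is nonnegative. *)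
Definition bd_width (F : fieldType) (N : chain_group F)
    (D : branch_decomposition (cg_ground N)) : rat :=
  \big[Num.max/0]_(p : bd_vertex D * bd_vertex D | bd_adj p.1 p.2)
    connectivity (bd_side p.1 p.2).

Definition is_branch_width (F : fieldType) (N : chain_group F) (w : rat) :
    Prop :=
  if (#|cg_ground N| <= 1)%N then w = 0
  else (exists D, @bd_width F N D = w) /\ (forall D, w <= @bd_width F N D).

Definition branch_width_at_most (F : fieldType) (N : chain_group F) (k : rat) :
    Prop :=
  exists2 w, is_branch_width N w & w <= k.

Definition well_quasi_order (Q : Type) (le : Q -> Q -> Prop) : Prop :=
  [/\ forall x, le x x,
      forall x y z, le x y -> le y z -> le x z
    & forall q : nat -> Q, exists i j : nat, (i < j)%N /\ le (q i) (q j)].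

Record labeled_chain_group (F : fieldType) (Q : Type) := LabeledChainGroup {
  lcg_group :> chain_group F;
  lcg_label : cg_ground lcg_group -> Q
}.

Inductive Q_minor (F : fieldType) (Q : Type) (le : Q -> Q -> Prop)
    (N : labeled_chain_group F Q) : labeled_chain_group F Q -> Prop :=
  QMinor (X Y : {set cg_ground N}) (label' : cg_ground (minor X Y) -> Q) :
    [disjoint X & Y] ->
    (forall v, le (label' v) (lcg_label (minor_val v))) ->
    Q_minor le N (LabeledChainGroup label').

Definition labeled_simply_isomorphic (F : fieldType) (Q : Type)
    (N N' : labeled_chain_group F Q) : Prop :=
  exists2 mu, @simple_isomorphism F N N' mu
            & forall v, lcg_label (mu v) = lcg_label v.

(* Main.v *)
From HB Require Import structures.
From Stdlib Require Import Classical ClassicalEpsilon.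
Require Import Defs.
From mathcomp Require Import all_boot all_order all_algebra all_fingroup zify.

(** Write [N x U] for the chains of [N] supported in [U]; for a Lagrangian [N]
    the connectivity of [U] is [#|U| - dim (N x U)], a symmetric submodular
    function. A branch-decomposition is turned into a laminar family of subsets
    of the ground set (the nodes of a rooted binary tree), and a family that
    minimizes a suitable potential is linked: for nested nodes [B <= A], the
    least connectivity of a set between them is attained at a node.

    The nodes of all the trees are then quasi-ordered: a node [A] carries the
    trace on [A] of its chain-group, each chain being colored by its class modulo
    [N x A + N x ~A]; as the connectivity is bounded and the field finite, a fixed
    finite set of colors suffices. One node is below another if its colored trace
    arises, up to a permutation of the colors, by deleting and contracting
    elements. The trace of a node is obtained from those of its two children by
    one of finitely many gluings, and Tutte's linking theorem gives [B <= A] for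
    linked nodes of equal connectivity. The minimal bad sequence argument of
    Robertson and Seymour's lemma on trees makes the nodes, hence the roots,
    well-quasi-ordered. *)

Set Implicit Arguments.
Unset Strict Implicit.
Unset Printing Implicit Defensive.

(** * Well-quasi-orders and the lemma on trees *)

(** The traces on two children do not by themselves determine the trace on their union: one must
    also know which pairs of traces come from a common chain. This depends only on the classes of
    the two traces, and the colors record exactly these classes. The colorings of different nodes
    are chosen independently, so linking compares two nodes only up to a renaming of colors, whereas
    a gluing is a table of actual colors. The renaming has to be made trivial on the children before
    they are glued; since the permutations of the colors form a finite group, the pigeonhole
    principle does it. Linking moreover needs two nodes of equal connectivity [j] with no smaller
    connectivity between them. The induction on trees therefore descends through the values of [j]:
    nodes of connectivity [j] serve as extra leaves for the trees whose inner nodes have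
    connectivity at least [j + 1], and minimal bad sequences are formed at one value of [j] at a
    time. *)

Lemma dep_choice (A : Type) (B : A -> Type) (R : forall x, B x -> Prop) :
  (forall x, exists y, R x y) -> exists f, forall x, R x (f x).
Proof.
move=> H; exists (fun x => proj1_sig (constructive_indefinite_description _ (H x))).
by move=> x; case: constructive_indefinite_description.
Qed.

Lemma fun_choice (A B : Type) (R : A -> B -> Prop) :
  (forall x, exists y, R x y) -> exists f, forall x, R x (f x).
Proof. exact: dep_choice. Qed.

Lemma homo_iter (g : nat -> nat) n0 : (forall n, n < g n) ->
  {homo (fun i => iter i g n0) : i j / i < j}.
Proof. by move=> hg; apply: homo_ltn => [x y z|i]; [apply: ltn_trans | apply: hg]. Qed.

Section WQO.
Variable E : Type.
Implicit Types (le : E -> E -> Prop) (P : E -> Prop) (s : nat -> E).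

Definition good le s := exists i j, i < j /\ le (s i) (s j).
Definition wqo_on le P := forall s, (forall n, P (s n)) -> good le s.

Lemma good_sub le s (phi : nat -> nat) :
  {homo phi : i j / i < j} -> good le (s \o phi) -> good le s.
Proof. by move=> hphi [i [j [ij h]]]; exists (phi i), (phi j); split=> //; apply: hphi. Qed.

Lemma wqo_chain le P s : (forall x y z, le x y -> le y z -> le x z) ->
  wqo_on le P -> (forall n, P (s n)) ->
  exists2 phi : nat -> nat, {homo phi : i j / i < j} &
    forall i j, i < j -> le (s (phi i)) (s (phi j)).
Proof.
move=> tr wP Ps.
(* Indices with no larger term after them are bounded: otherwise they would index a bad sequence. *)
have [n0 Hn0] : exists n0, forall n, n0 <= n -> exists m, n < m /\ le (s n) (s m).
  apply: NNPP => H.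
  have {}H n0 : exists n, n0 < n /\ forall m, n < m -> ~ le (s n) (s m).
    apply: NNPP => H'; apply: H; exists n0.+1 => n hn; apply: NNPP => H2.
    by apply: H'; exists n; split=> // m hm hle; apply: H2; exists m.
  have [g hg] := fun_choice H.
  (* Starting from [i.+1] makes every [phi i], including the first, a value of [g], hence such an
     index. *)
  pose phi i := iter i.+1 g 0.
  have hphi : {homo phi : i j / i < j}.
    by move=> i j ij; apply: homo_iter => // n; case: (hg n).
  have [i [j [ij]]] := wP (s \o phi) (fun n => Ps _).
  by rewrite /= /phi iterS; apply: (hg _).2; apply: hphi.
have {}Hn0 n : exists m, n < m /\ (n0 <= n -> le (s n) (s m)).
  have [/Hn0[m [nm h]]|_] := leqP n0 n; first by exists m.
  by exists n.+1; split.
have [g hg] := fun_choice Hn0.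
exists (fun i => iter i g n0); first by apply: homo_iter => n; case: (hg n).
have ge i : n0 <= iter i g n0.
  by elim: i => //= i IH; apply: leq_trans IH (ltnW (hg _).1).
by apply: homo_ltn => [y x z|i /=]; [apply: tr | apply: (hg _).2].
Qed.

Lemma wqo_onU le P1 P2 : wqo_on le P1 -> wqo_on le P2 ->
  wqo_on le (fun x => P1 x \/ P2 x).
Proof.
move=> w1 w2 s Ps.
have [H|H] := classic (exists n0, forall n, n0 < n -> P1 (s n)).
  have [n0 Hn0] := H.
  apply: (@good_sub _ _ (fun i => n0.+1 + i)); first by move=> i j; rewrite ltn_add2l.
  by apply: w1 => n; apply: Hn0; rewrite addSn ltnS leq_addr.
have {}H n0 : exists n, n0 < n /\ P2 (s n).
  apply: NNPP => H'; apply: H; exists n0 => n hn.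
  by case: (Ps n) => // h; case: H'; exists n.
have [g hg] := fun_choice H.
apply: (@good_sub _ _ (fun i => iter i g (g 0))).
  by apply: homo_iter => n; case: (hg n).
by apply: w2 => -[|n] /=; apply: (hg _).2.
Qed.

Lemma wqo_on_sub le P1 P2 : (forall x, P1 x -> P2 x) -> wqo_on le P2 -> wqo_on le P1.
Proof. by move=> h w s Ps; apply: w => n; apply: h. Qed.

(** * Minimal bad sequences *)

Section MinimalBad.
Variables (le : E -> E -> Prop) (P : E -> Prop) (size : E -> nat).
Let bad s := (forall n, P (s n)) /\ ~ good le s.

(** Each [T n] is bad and final below [n]; [T n.+1] keeps these terms and minimizes the size at [n].
    The diagonal is bad because any two of its terms occur together in a single [T n]. *)
Lemma minimal_bad_sequence : ~ wqo_on le P ->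
  exists2 s, bad s & forall n t, bad t -> (forall i, i < n -> t i = s i) ->
    size (s n) <= size (t n).
Proof.
move=> nw.
have [t0 bt0] : exists t, bad t.
  apply: NNPP => H; apply: nw => s Ps; apply: NNPP => H'; by apply: H; exists s.
have H (nt : nat * (nat -> E)) : exists t', bad nt.2 ->
    [/\ bad t', forall i, i < nt.1 -> t' i = nt.2 i &
     forall u, bad u -> (forall i, i < nt.1 -> u i = nt.2 i) -> size (t' nt.1) <= size (u nt.1)].
  case: nt => n t /=.
  have [bt|nbt] := classic (bad t); last by exists t.
  pose Q m := exists u, [/\ bad u, forall i, i < n -> u i = t i & size (u n) = m].
  have : exists m, Q m by exists (size (t n)), t.
  case=> m0; elim/ltn_ind: m0 => m0 IH Qm0.
  have [[m [mm Qm]]|Hm] := classic (exists m, m < m0 /\ Q m); first exact: IH Qm.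
  have [u [bu ut um]] := Qm0; exists u => _; split=> // v bv vt.
  rewrite um leqNgt; apply/negP => hlt; apply: Hm; exists (size (v n)); split=> //.
  by exists v.
have [c hc] := fun_choice H.
pose T := fix T n := if n is m.+1 then c (m, T m) else t0.
have bT n : bad (T n) by elim: n => //= n /(hc (n, T n))[].
have TS n i : i < n -> T n.+1 i = T n i.
  by move=> ni /=; have [_ h _] := hc (n, T n) (bT n); apply: h.
have Tn m n i : i < m -> m <= n -> T n i = T m i.
  move=> im; elim: n => [|n IH]; first by rewrite leqn0 => /eqP ->.
  rewrite leq_eqVlt => /orP[/eqP -> //|]; rewrite ltnS => mn.
  by rewrite TS ?IH // (leq_trans im).
exists (fun n => T n.+1 n).
  split=> [n|[i [j [ij h]]]]; first by have [] := bT n.+1.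
  have [_] := bT j.+1; apply; exists i, j; split=> //.
  by rewrite (Tn i.+1 j.+1 i) // ltnS ltnW.
move=> n t bt ht; have [_ _ hm] := hc (n, T n) (bT n); apply: hm => // i ni /=.
by rewrite ht // (Tn i.+1 n i).
Qed.

(** Let [x] be a bad sequence of such elements, and [m] an index for which [I m] is least. The
    sequence that follows [s] up to [I m] and continues with [x m], [x m.+1], ... is bad again: if
    [s i] were below [x n], it would be below [s (I n)], where [i < I m <= I n]. Its term at [I m]
    is too small. *)
Lemma wqo_below_minimal s : (forall x y z, le x y -> le y z -> le x z) ->
  bad s -> (forall n t, bad t -> (forall i, i < n -> t i = s i) ->
    size (s n) <= size (t n)) ->
  wqo_on le (fun x => P x /\ exists i, le x (s i) /\ size x < size (s i)).
Proof.
move=> tr bs mins x Px; apply: NNPP => nx.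
have [I hI] : exists I : nat -> nat, forall n, le (x n) (s (I n)) /\ size (x n) < size (s (I n)).
  apply: (@fun_choice _ _ (fun n i => le (x n) (s i) /\ size (x n) < size (s i))) => n.
  by have [] := Px n.
have [m hm] : exists m, forall n, I m <= I n.
  have : exists k m, I m = k by exists (I 0), 0.
  case=> k; elim/ltn_ind: k => k IH [m hm].
  have [[n hn]|H] := classic (exists n, I n < I m).
    by apply: (IH (I n)); [rewrite -hm | exists n].
  by exists m => n; rewrite leqNgt; apply/negP => h; apply: H; exists n.
pose t i := if i < I m then s i else x (m + (i - I m)).
suff bt : bad t.
  have := mins (I m) t bt; rewrite {2}/t ltnn subnn addn0 => h.
  have: size (s (I m)) <= size (x m) by apply: h => i hi; rewrite /t hi.
  by rewrite leqNgt (hI m).2.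
split=> [n|[i [j [ij]]]].
  by rewrite /t; case: ifP => _; [case: bs | case: (Px (m + (n - I m)))].
rewrite /t; have [jm|jm] := ltnP j (I m).
  by rewrite (ltn_trans ij jm) => h; case: bs => _; apply; exists i, j.
have [im|im] := ltnP i (I m) => h.
  case: bs => _; apply; exists i, (I (m + (j - I m))); split.
    by apply: leq_trans im (hm _).
  by apply: (tr _ (x (m + (j - I m)))) => //; case: (hI (m + (j - I m))).
by apply: nx; exists (m + (i - I m)), (m + (j - I m)); split=> //; rewrite ltn_add2l ltn_sub2r
  // (leq_ltn_trans im ij).
Qed.
End MinimalBad.

End WQO.

Lemma wqo_finType (T : finType) : wqo_on (@eq T) (fun _ => True).
Proof.
move=> s _; apply: NNPP => H.
have inj : injective (fun i : 'I_#|T|.+1 => s i).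
  move=> i j hs; apply: val_inj; have [ij|ji|//] := ltngtP i j; case: H.
    by exists i, j.
  by exists j, i.
by have := leq_card _ inj; rewrite card_ord ltnn.
Qed.

(** * The lemma on trees, abstractly *)

Section LemmaOnTrees.
Variables (E : Type) (le : E -> E -> Prop) (size lev : E -> nat) (K : nat).
Variable spl : E -> E -> E -> Prop.

Inductive trunk (j : nat) (L : E -> Prop) (a : E) : Prop :=
| Trunk_leaf of L a
| Trunk_node b c of spl a b c & j <= lev a & trunk j L b & trunk j L c.

(** The level of the endpoint is left free: a path is followed down to the first node where the
    level may be [j] again. *)
Inductive high_path (j : nat) : E -> E -> Prop :=
| High_path_nil a : high_path j a a
| High_path_left a b c d : high_path j a b -> j <= lev b -> spl b c d -> high_path j a c
| High_path_right a b c d : high_path j a b -> j <= lev b -> spl b d c -> high_path j a c.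

Hypothesis le_trans : forall x y z, le x y -> le y z -> le x z.
Hypothesis levK : forall a, lev a <= K.
Hypothesis spl_size : forall a b c, spl a b c -> size b < size a /\ size c < size a.
Hypothesis linked : forall j a b, high_path j a b -> lev a = j -> lev b = j -> le b a.
Hypothesis spl_good : forall W a b c, wqo_on le W ->
  (forall n, spl (a n) (b n) (c n)) -> (forall n, W (b n)) -> (forall n, W (c n)) ->
  good le a.

(** Downward induction on [j]: beyond [K] there are no inner nodes, so a trunk is a leaf. *)
Lemma wqo_trunk j L : wqo_on le L -> wqo_on le (trunk j L).
Proof.
elim: {j}(K.+1 - j) {-2}j (leqnn (K.+1 - j)) L => [|m IH] j hj L wL.
  apply: wqo_on_sub wL => a [//|b c _ hja].
  by move: hj; rewrite leqn0 subn_eq0 leqNgt ltnS (leq_trans hja (levK a)).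
have {}IH M : wqo_on le M -> wqo_on le (trunk j.+1 M).
  by apply: IH; lia.
(* The nodes of level exactly [j] suffice: once they count as leaves, the remaining inner nodes have
   level at least [j.+1]. *)
pose S a := exists b c, [/\ spl a b c, lev a = j, trunk j L b & trunk j L c].
suff wS : wqo_on le S.
  apply: wqo_on_sub (IH _ (wqo_onU wL wS)) => a; elim=> [b Lb|b c d bcd hj' tc IHc td IHd].
    by apply: Trunk_leaf; left.
  have [jb|jb|jb] := ltngtP j (lev b); [exact: Trunk_node bcd _ _ _ | lia | ].
  by apply: Trunk_leaf; right; exists c, d.
apply: NNPP => nS.
have [s bs mins] := minimal_bad_sequence size nS.
pose B x := S x /\ exists i, le x (s i) /\ size x < size (s i).
have wB : wqo_on le B := wqo_below_minimal le_trans bs mins.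
pose L' x := L x \/ B x.
have wL' : wqo_on le L' by apply: wqo_onU.
(* Cut the tree below [s n] at the first nodes of level [j]. By linkedness they are below [s n], and
   they are smaller, so they belong to [B]. *)
have key n x : high_path j (s n) x -> size x < size (s n) -> trunk j L x -> trunk j.+1 L' x.
  move=> hp sx tx; elim: tx hp sx => {x} [x Lx|x b c xbc jx tb IHb tc IHc] hp sx.
    by apply: Trunk_leaf; left.
  have [sb sc] := spl_size xbc.
  have [jlt|jgt|jeq] := ltngtP j (lev x); [|lia|].
    apply: (Trunk_node xbc) => //.
      by apply: IHb; [exact: High_path_left hp jx xbc | exact: ltn_trans sx].
    by apply: IHc; [exact: High_path_right hp jx xbc | exact: ltn_trans sx].
  apply: Trunk_leaf; right; split; first by exists b, c.
  exists n; split=> //; apply: linked hp _ _ => //.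
  by have [b' [c' []]] := bs.1 n.
have [b hb] := fun_choice bs.1.
have [c hc] := fun_choice hb.
apply: bs.2; apply: (spl_good (IH _ wL') (b := b) (c := c)).
    by move=> n; case: (hc n).
  move=> n; have [sp lv tb tc] := hc n; apply: (key n) tb; last by case: (spl_size sp).
  by apply: High_path_left (High_path_nil _ _) _ sp; rewrite lv.
move=> n; have [sp lv tb tc] := hc n; apply: (key n) tc; last by case: (spl_size sp).
by apply: High_path_right (High_path_nil _ _) _ sp; rewrite lv.
Qed.
End LemmaOnTrees.

(** * Linked tree families *)

Lemma sum_expn_lt (p : nat -> nat) M n : (forall w, p w < M) ->
  \sum_(w < n) p w * M ^ w < M ^ n.
Proof.
move=> hp; elim: n => [|n IH]; first by rewrite big_ord0.
rewrite big_ord_recr /= expnS.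
apply: (@leq_trans ((p n).+1 * M ^ n)); last by rewrite leq_mul2r hp orbT.
by rewrite mulSn ltn_add2r.
Qed.

(** In base [M], a drop at digit [w0] outweighs any change of the lower digits. *)
Lemma sum_expn_lex (p p' : nat -> nat) M n w0 : (forall w, p' w < M) ->
  w0 < n -> (forall w, w0 <= w -> p' w <= p w) -> p' w0 < p w0 ->
  \sum_(w < n) p' w * M ^ w < \sum_(w < n) p w * M ^ w.
Proof.
move=> hp; elim: n => // n IH; rewrite ltnS leq_eqVlt => /orP[/eqP -> |w0n] hle hlt.
  rewrite !big_ord_recr /= [ltnRHS]addnC; apply: ltn_addr.
  apply: (@leq_trans ((p' n).+1 * M ^ n)); last by rewrite leq_mul2r hlt orbT.
  by rewrite mulSn ltn_add2r sum_expn_lt.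
rewrite !big_ord_recr /= -addSn leq_add ?IH //.
by rewrite leq_mul2r hle ?orbT // ltnW.
Qed.

Section TreeFamilies.
Variable V : finType.
Implicit Types (X Y Z W U A B : {set V}) (T : {set {set V}}).

Definition laminar T := forall X Y, X \in T -> Y \in T ->
  X \subset Y \/ Y \subset X \/ [disjoint X & Y].

Definition splittable T X := #|X| = 1 \/ exists X1 X2,
  [/\ X1 \in T, X2 \in T, X1 :|: X2 = X & [disjoint X1 & X2]].

Definition tree_family T :=
  [/\ setT \in T, set0 \notin T, laminar T & forall X, X \in T -> splittable T X].

Definition crosses X Z := [&& ~~ [disjoint X & Z], ~~ (X \subset Z) & ~~ (Z \subset X)].

Lemma disjoint_nP X Y : reflect (exists2 x, x \in X & x \in Y) (~~ [disjoint X & Y]).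
Proof.
apply: (iffP pred0Pn) => [[x /andP[xX xY]]|[x xX xY]]; first by exists x.
by exists x; apply/andP.
Qed.

Lemma disjoint_sub X Y X' Y' : X' \subset X -> Y' \subset Y ->
  [disjoint X & Y] -> [disjoint X' & Y'].
Proof. by move=> hX hY /(disjointWl hX)/(disjointWr hY). Qed.

(** * Uncrossing a tree family with a set between two of its nodes *)

Section Uncrossing.
Variables (T : {set {set V}}) (A B Z : {set V}).
Hypotheses (treeT : tree_family T) (AT : A \in T) (BT : B \in T).
Hypotheses (BZ : B \subset Z) (ZA : Z \subset A).

(** Two copies of the tree are joined at [Z]. The lower copy is the tree induced on [Z]. In the
    upper copy the node [B] is blown up to [Z]: nodes containing [B] gain [Z], nodes disjoint from
    [B] lose it. *)
Definition uncrossed_family : {set {set V}} :=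
  ([set X :&: Z | X in T] :|: [set X :\: Z | X in T & [disjoint X & B]]
   :|: [set X :|: Z | X in T & B \subset X]) :\ set0.
Local Notation T' := uncrossed_family.

Lemma uncrossedP W : reflect (W <> set0 /\ exists2 X, X \in T &
   [\/ W = X :&: Z, [disjoint X & B] /\ W = X :\: Z | B \subset X /\ W = X :|: Z]) (W \in T').
Proof.
rewrite !inE; apply: (iffP andP) => [[/eqP W0 H]|[/eqP W0 [X XT H]]]; split=> //.
  case/orP: H => [/orP[] /imsetP[X]|/imsetP[X]].
  - by move=> XT ->; exists X => //; constructor 1.
  - by rewrite inE => /andP[XT d] ->; exists X => //; constructor 2.
  by rewrite inE => /andP[XT d] ->; exists X => //; constructor 3.
case: H => [->|[d ->]|[d ->]].
- by rewrite (@imset_f _ _ (fun X => X :&: Z)).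
- by rewrite (@imset_f _ _ (fun X => X :\: Z)) ?orbT // inE XT.
by rewrite (@imset_f _ _ (fun X => X :|: Z)) ?orbT // inE XT.
Qed.

Let lamT : laminar T. Proof. by case: treeT. Qed.
Let T0 X : X \in T -> X <> set0.
Proof. by move=> XT X0; case: treeT => _ /negP; rewrite -X0. Qed.

Lemma tree_family_B X : X \in T -> X :&: B != set0 -> ~~ (B \subset X) -> X \subset B.
Proof.
move=> XT XB nB; case: (lamT XT BT) => [//|[h|]]; first by rewrite h in nB.
by rewrite -setI_eq0 => h; rewrite h in XB.
Qed.

Lemma mem_uncrossedI X : X \in T -> X :&: Z <> set0 -> X :&: Z \in T'.
Proof. by move=> XT n0; apply/uncrossedP; split=> //; exists X => //; constructor 1. Qed.
Lemma mem_uncrossedD X : X \in T -> [disjoint X & B] -> X :\: Z <> set0 -> X :\: Z \in T'.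
Proof. by move=> XT d n0; apply/uncrossedP; split=> //; exists X => //; constructor 2. Qed.
Lemma mem_uncrossedU X : X \in T -> B \subset X -> X :|: Z \in T'.
Proof.
move=> XT d; apply/uncrossedP; split; last by exists X => //; constructor 3.
by move/eqP; rewrite setU_eq0 => /andP[/eqP/(T0 XT)].
Qed.

Lemma mem_uncrossed_Z : Z \in T'.
Proof.
rewrite -(setIidPr ZA); apply: mem_uncrossedI => //; rewrite (setIidPr ZA) => Z0.
by move: BZ; rewrite Z0 subset0 => /eqP/(T0 BT).
Qed.

Lemma crosses_BVdisjoint X : X \in T -> crosses X Z -> B \subset X \/ [disjoint X & B].
Proof.
move=> XT /and3P[_ XZ _]; case: (lamT XT BT) => [XB|[|]]; [|by left|by right].
by rewrite (subset_trans XB BZ) in XZ.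
Qed.

Lemma mem_uncrossed_T X : X \in T -> ~~ crosses X Z -> X \in T'.
Proof.
move=> XT; rewrite /crosses !negb_and !negbK => /or3P[d|s|s].
- have e : X :\: Z = X by apply/setDidPl.
  rewrite -e; apply: mem_uncrossedD => //; last by rewrite e; apply: T0.
  exact: disjointWr d.
- rewrite -(setIidPl s); apply: mem_uncrossedI => //.
  by rewrite (setIidPl s); apply: T0.
rewrite -(setUidPl s); apply: mem_uncrossedU => //; exact: subset_trans s.
Qed.

Lemma uncrossed_laminar : laminar T'.
Proof.
move=> W1 W2 /uncrossedP[n1 [X1 X1T h1]] /uncrossedP[n2 [X2 X2T h2]].
have := lamT X1T X2T.
case: h1 h2 => [->|[d1 ->]|[d1 ->]] [->|[d2 ->]|[d2 ->]].
- move=> [h|[h|h]]; [left|right;left|right;right].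
  + exact: setSI.
  + exact: setSI.
  + by apply: disjoint_sub h; apply: subsetIl.
- move=> _; right; right; rewrite -setI_eq0; apply/eqP/setP => x; rewrite !inE.
  by case: (x \in Z); rewrite ?andbF.
- by move=> _; left; apply: subset_trans (subsetIr _ _) (subsetUr _ _).
- move=> _; right; right; rewrite -setI_eq0; apply/eqP/setP => x; rewrite !inE.
  by case: (x \in Z); rewrite ?andbF.
- move=> [h|[h|h]]; [left|right;left|right;right].
  + exact: setSD.
  + exact: setSD.
  + by apply: disjoint_sub h; apply: subsetDl.
- move=> [h|[h|h]].
  + by left; apply: subset_trans (subsetDl _ _) (subset_trans h (subsetUl _ _)).
  + have := T0 BT; move: (disjointWl (subset_trans d2 h) d1).
    by rewrite -setI_eq0 setIid => /eqP.
  right; right; rewrite -setI_eq0; apply/eqP/setP => x; rewrite !inE.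
  case: (boolP (x \in X1)) => [x1|]; rewrite ?andbF //=.
  by rewrite (disjointFr h x1); case: (x \in Z).
- by move=> _; right; left; apply: subset_trans (subsetIr _ _) (subsetUr _ _).
- move=> [h|[h|h]].
  + have := T0 BT; move: (disjointWl (subset_trans d1 h) d2).
    by rewrite -setI_eq0 setIid => /eqP.
  + by right; left; apply: subset_trans (subsetDl _ _) (subset_trans h (subsetUl _ _)).
  right; right; rewrite -setI_eq0; apply/eqP/setP => x; rewrite !inE.
  case: (boolP (x \in X2)) => [x1|]; rewrite ?andbF //=.
  by rewrite (disjointFl h x1); case: (x \in Z).
move=> [h|[h|h]]; [left|right;left|].
+ exact: setSU.
+ exact: setSU.
have := T0 BT; move: (disjoint_sub d1 d2 h); by rewrite -setI_eq0 setIid => /eqP.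
Qed.

Let split_lt X X1 X2 : X2 \in T -> X1 :|: X2 = X -> [disjoint X1 & X2] -> #|X1| < #|X|.
Proof.
move=> X2T <- d; rewrite cardsU; move: d; rewrite -setI_eq0 => /eqP ->.
rewrite cards0 subn0 -addn1 leq_add2l card_gt0; exact/eqP/T0.
Qed.

Let card1_sub X Y : #|X| = 1 -> Y \subset X -> Y <> set0 -> #|Y| = 1.
Proof.
move=> X1 YX /eqP; rewrite -card_gt0 => Y0; have := subset_leq_card YX; lia.
Qed.

(** When a half of [X] misses [Z], [X :&: Z] is the trace of the other half alone and gets its
    splitting from there; hence the induction on the size. *)
Lemma splittable_uncrossedI X : X \in T -> X :&: Z <> set0 -> splittable T' (X :&: Z).
Proof.
elim/ltn_ind: {X}(#|X|) {-2}X (erefl #|X|) => n IH X Xn XT n0.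
have [_ _ _ /(_ X XT)[X1|[X1 [X2 [X1T X2T XE d]]]]] := treeT.
  by left; apply: card1_sub X1 (subsetIl _ _) n0.
have h1 := split_lt X2T XE d; rewrite Xn in h1.
have h2 : #|X2| < n by rewrite -Xn; apply: split_lt X1T _ _; rewrite 1?setUC // disjoint_sym.
have [e1|/eqP e1] := eqVneq (X1 :&: Z) set0.
  have E : X :&: Z = X2 :&: Z by rewrite -XE setIUl e1 set0U.
  by rewrite E; apply: (IH _ h2) => //; rewrite -E.
have [e2|/eqP e2] := eqVneq (X2 :&: Z) set0.
  have E : X :&: Z = X1 :&: Z by rewrite -XE setIUl e2 setU0.
  by rewrite E; apply: (IH _ h1) => //; rewrite -E.
right; exists (X1 :&: Z), (X2 :&: Z); split; try exact: mem_uncrossedI.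
  by rewrite -setIUl XE.
by apply: disjoint_sub d; apply: subsetIl.
Qed.

Lemma splittable_uncrossedD X : X \in T -> [disjoint X & B] -> X :\: Z <> set0 ->
  splittable T' (X :\: Z).
Proof.
elim/ltn_ind: {X}(#|X|) {-2}X (erefl #|X|) => n IH X Xn XT dB n0.
have [_ _ _ /(_ X XT)[X1|[X1 [X2 [X1T X2T XE d]]]]] := treeT.
  by left; apply: card1_sub X1 (subsetDl _ _) n0.
have h1 := split_lt X2T XE d; rewrite Xn in h1.
have h2 : #|X2| < n by rewrite -Xn; apply: split_lt X1T _ _; rewrite 1?setUC // disjoint_sym.
have d1 : [disjoint X1 & B] by apply: disjointWl dB; rewrite -XE subsetUl.
have d2 : [disjoint X2 & B] by apply: disjointWl dB; rewrite -XE subsetUr.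
have [e1|/eqP e1] := eqVneq (X1 :\: Z) set0.
  have E : X :\: Z = X2 :\: Z by rewrite -XE setDUl e1 set0U.
  by rewrite E; apply: (IH _ h2) => //; rewrite -E.
have [e2|/eqP e2] := eqVneq (X2 :\: Z) set0.
  have E : X :\: Z = X1 :\: Z by rewrite -XE setDUl e2 setU0.
  by rewrite E; apply: (IH _ h1) => //; rewrite -E.
right; exists (X1 :\: Z), (X2 :\: Z); split; try exact: mem_uncrossedD.
  by rewrite -setDUl XE.
by apply: disjoint_sub d; apply: subsetDl.
Qed.

Lemma splittable_uncrossedU X : X \in T -> B \subset X -> splittable T' (X :|: Z).
Proof.
elim/ltn_ind: {X}(#|X|) {-2}X (erefl #|X|) => n IH X Xn XT BX.
have [XZ|XZ] := boolP (X \subset Z).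
  rewrite (setUidPr XZ) -(setIidPr ZA); apply: splittable_uncrossedI => //.
  rewrite (setIidPr ZA) => Z0; by move: BZ; rewrite Z0 subset0 => /eqP/(T0 BT).
have [_ _ _ /(_ X XT)[X1|[X1 [X2 [X1T X2T XE d]]]]] := treeT.
  case/negP: XZ; suff <- : B = X by [].
  apply/eqP; rewrite eqEcard BX X1 card_gt0; exact/eqP/T0.
have h1 := split_lt X2T XE d; rewrite Xn in h1.
have h2 : #|X2| < n by rewrite -Xn; apply: split_lt X1T _ _; rewrite 1?setUC // disjoint_sym.
(* One half contains [B]: otherwise both halves meet [B] and by laminarity lie in it, so that [X] is
   contained in [B] and in [Z]. *)
wlog BX1 : X1 X2 X1T X2T XE d h1 h2 / B \subset X1.
  move=> W.
  have [B1|n1] := boolP (B \subset X1); first exact: (W X1 X2).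
  have [B2|n2] := boolP (B \subset X2).
    by apply: (W X2 X1) => //; rewrite 1?setUC // disjoint_sym.
  have [e|e] := eqVneq (X1 :&: B) set0.
    case/negP: n2; apply/subsetP => x xB; move/subsetP: BX => /(_ x xB).
    rewrite -XE inE => /orP[x1|//]; move/setP: e => /(_ x); by rewrite !inE x1 xB.
  have [e2|e2] := eqVneq (X2 :&: B) set0.
    case/negP: n1; apply/subsetP => x xB; move/subsetP: BX => /(_ x xB).
    rewrite -XE inE => /orP[//|x1]; move/setP: e2 => /(_ x); by rewrite !inE x1 xB.
  have s1 := tree_family_B X1T e n1; have s2 := tree_family_B X2T e2 n2.
  by case/negP: XZ; rewrite -XE subUset !(subset_trans _ BZ).
have d2 : [disjoint X2 & B] by apply: disjointWr BX1 _; rewrite disjoint_sym.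
have [e2|/eqP e2] := eqVneq (X2 :\: Z) set0.
  suff -> : X :|: Z = X1 :|: Z by apply: IH h1 _ _ _ _.
  rewrite -XE -setUA; congr (_ :|: _); apply/setUidPr.
  by rewrite -setD_eq0 e2.
right; exists (X1 :|: Z), (X2 :\: Z); split.
- exact: mem_uncrossedU.
- exact: mem_uncrossedD.
- by rewrite -XE; apply/setP => x; rewrite !inE; case: (x \in Z); rewrite ?orbT ?orbF.
rewrite -setI_eq0; apply/eqP/setP => x; rewrite !inE.
case: (boolP (x \in X2)) => [x1|]; rewrite ?andbF //=.
by rewrite (disjointFl d x1); case: (x \in Z).
Qed.

Lemma uncrossed_tree : tree_family T'.
Proof.
split.
- have [VT _ _ _] := treeT.
  by rewrite -(setTU Z); apply: mem_uncrossedU.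
- by rewrite !inE eqxx.
- exact: uncrossed_laminar.
move=> W /uncrossedP[W0 [X XT]] [E|[d E]|[d E]]; rewrite E in W0 *.
- exact: splittable_uncrossedI.
- exact: splittable_uncrossedD.
exact: splittable_uncrossedU.
Qed.
End Uncrossing.

(** * Linkedness by minimizing a potential *)

Section Linked.
Variable lam : {set V} -> nat.
Hypothesis lamC : forall X, lam (~: X) = lam X.
Hypothesis lam_submod : forall X Y, lam (X :&: Y) + lam (X :|: Y) <= lam X + lam Y.

Lemma lam_posimod X Y : lam (X :\: Y) + lam (Y :\: X) <= lam X + lam Y.
Proof.
have := lam_submod X (~: Y); rewrite lamC.
by rewrite -[lam (X :|: ~: Y)]lamC setCU setCK -!setDE setIC -setDE.
Qed.

Definition linked_family T := forall A B Z, A \in T -> B \in T ->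
  B \subset Z -> Z \subset A ->
  exists2 Y, Y \in T & [/\ B \subset Y, Y \subset A & lam Y <= lam Z].

(* Counting pairs of nodes joined by a path of connectivity at least [w], rather
   than nodes, rewards the insertion of a node of small connectivity between
   two nodes of large connectivity. *)
Definition high_pairs T w := [set p : {set V} * {set V} |
  [&& p.1 \in T, p.2 \in T, p.1 \subset p.2 &
   [forall Y in T, (p.1 \subset Y) && (Y \subset p.2) ==> (w <= lam Y)]]].

Lemma high_pairsP T w X Y : reflect ([/\ X \in T, Y \in T, X \subset Y &
   forall W, W \in T -> X \subset W -> W \subset Y -> w <= lam W]) ((X, Y) \in high_pairs T w).
Proof.
rewrite inE /=; apply: (iffP and4P) => -[XT YT XY h]; split=> //.
  by move=> W WT XW WY; move/forallP: h => /(_ W); rewrite WT XW WY.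
by apply/forallP => W; apply/implyP => WT; apply/implyP => /andP[]; apply: h.
Qed.

(** The base exceeds every digit, so potentials compare lexicographically, the highest connectivity
    being the most significant. *)
Definition potential T :=
  \sum_(w < (\max_(X : {set V}) lam X).+1)
     #|high_pairs T w| * #|{: {set V} * {set V}}|.+1 ^ w.

Section Step.
Variables (T : {set {set V}}) (A B Z : {set V}).
Hypotheses (treeT : tree_family T) (AT : A \in T) (BT : B \in T).
Hypotheses (BZ : B \subset Z) (ZA : Z \subset A).
Hypothesis lamZ : forall Y, Y \in T -> B \subset Y -> Y \subset A -> lam Z < lam Y.
Let ncross W := #|[set X in T | crosses X W]|.
Hypothesis Zcross : forall W, B \subset W -> W \subset A -> ncross W < ncross Z -> lam Z < lam W.
Local Notation T' := (uncrossed_family T B Z).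

Let lamT : laminar T. Proof. by case: treeT. Qed.
Let T0 X : X \in T -> X <> set0.
Proof. by move=> XT X0; case: treeT => _ /negP; rewrite -X0. Qed.

Let ncross_lt X W : X \in T -> crosses X Z -> ~~ crosses X W ->
  (forall Y, Y \in T -> crosses Y W -> crosses Y Z) -> ncross W < ncross Z.
Proof.
move=> XT XZ XW h; apply: proper_card; apply/properP; split.
  by apply/subsetP => Y; rewrite !inE => /andP[YT /(h Y YT)->]; rewrite YT.
by exists X; rewrite !inE XT //= ?XZ.
Qed.

Lemma crosses_sub_A X : X \in T -> crosses X Z -> X \subset A.
Proof.
move=> XT /and3P[d s1 s2]; case: (lamT XT AT) => [//|[h|h]].
  by rewrite (subset_trans ZA h) in s2.
by rewrite (disjointWr ZA h) in d.
Qed.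

(* [X :&: Z] and [X :|: Z] cross fewer nodes than [Z], so by the choice of [Z]
   their connectivity exceeds [lam Z]; submodularity does the rest. *)
Lemma lam_crossedI_U X : X \in T -> crosses X Z -> B \subset X ->
  lam (X :&: Z) < lam X /\ lam (X :|: Z) < lam X.
Proof.
move=> XT cX BX; have XA := crosses_sub_A XT cX.
have [dXZ XZ ZX] := and3P cX.
have hI : lam Z < lam (X :&: Z).
  apply: Zcross; first by rewrite subsetI BX.
    exact: subset_trans (subsetIr _ _) ZA.
  apply: (ncross_lt XT cX); first by rewrite /crosses subsetIl !andbF.
  move=> Y YT /and3P[d s1 s2]; apply/and3P; split.
  - by apply: contra d; apply: disjointWr; apply: subsetIr.
  - case: (lamT YT XT) => [YX|[XY|h]].
    + by apply: contra s1; rewrite subsetI YX.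
    + by rewrite (subset_trans (subsetIl _ _) XY) in s2.
    + by rewrite (disjointWr (subsetIl _ _) h) in d.
  by apply: contra s2; apply: subset_trans (subsetIr _ _).
have hU : lam Z < lam (X :|: Z).
  apply: Zcross; first exact: subset_trans BX (subsetUl _ _).
    by rewrite subUset XA.
  apply: (ncross_lt XT cX); first by rewrite /crosses subsetUl !andbF.
  move=> Y YT /and3P[d s1 s2].
  have s1' : ~~ (Y \subset Z) by apply: contra s1 => h; rewrite (subset_trans h) // subsetUr.
  have [b bB] : exists b, b \in B by apply/set0Pn/eqP/T0.
  case: (lamT YT XT) => [YX|[XY|h]].
  + by rewrite (subset_trans YX (subsetUl _ _)) in s1.
  + apply/and3P; split=> //.
      by apply/disjoint_nP; exists b; [apply: (subsetP XY); apply: (subsetP BX) | apply: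
        (subsetP BZ)].
    by apply: contra s2; rewrite subUset XY.
  apply/and3P; split=> //.
    case/disjoint_nP: d => y yY; rewrite inE (disjointFr h yY) /= => yZ.
    by apply/disjoint_nP; exists y.
  apply/negP => /subsetP/(_ b ((subsetP BZ) b bB)) bY.
  by have := disjointFr h bY; rewrite (subsetP BX).
have := lam_submod X Z; lia.
Qed.

(** Here [X :&: Z] does not contain [B]. The competitors of [Z] are [Z :\: X] and [X :|: Z], and
    posimodularity is used beside submodularity. *)
Lemma lam_crossedI_D X : X \in T -> crosses X Z -> [disjoint X & B] ->
  lam (X :&: Z) < lam X /\ lam (X :\: Z) < lam X.
Proof.
move=> XT cX dB; have XA := crosses_sub_A XT cX.
have [dXZ XZ ZX] := and3P cX.
have hD : lam Z < lam (Z :\: X).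
  apply: Zcross; first by rewrite subsetD BZ disjoint_sym.
    exact: subset_trans (subsetDl _ _) ZA.
  have dD : [disjoint X & Z :\: X].
    rewrite -setI_eq0; apply/eqP/setP => x; rewrite !inE.
    by case: (x \in X).
  apply: (ncross_lt XT cX); first by rewrite /crosses dD.
  move=> Y YT /and3P[d s1 s2]; apply/and3P; split.
  - by apply: contra d; apply: disjointWr; apply: subsetDl.
  - case: (lamT YT XT) => [YX|[XY|h]].
    + by rewrite (disjointWl YX dD) in d.
    + by apply: contra XZ; apply: subset_trans.
    + by apply: contra s1; rewrite subsetD h andbT.
  by apply: contra s2; apply: subset_trans (subsetDl _ _).
have hU : lam Z < lam (X :|: Z).
  apply: Zcross; first exact: subset_trans BZ (subsetUr _ _).
    by rewrite subUset XA.
  apply: (ncross_lt XT cX); first by rewrite /crosses subsetUl !andbF.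
  move=> Y YT /and3P[d s1 s2].
  have s1' : ~~ (Y \subset Z) by apply: contra s1 => h; rewrite (subset_trans h) // subsetUr.
  have [b bX bZ] := disjoint_nP _ _ dXZ.
  case: (lamT YT XT) => [YX|[XY|h]].
  + by rewrite (subset_trans YX (subsetUl _ _)) in s1.
  + apply/and3P; split=> //.
      by apply/disjoint_nP; exists b => //; apply: (subsetP XY).
    by apply: contra s2; rewrite subUset XY.
  apply/and3P; split=> //.
    case/disjoint_nP: d => y yY; rewrite inE (disjointFr h yY) /= => yZ.
    by apply/disjoint_nP; exists y.
  apply/negP => /subsetP/(_ b bZ) bY.
  by have := disjointFr h bY; rewrite bX.
have := lam_submod X Z; have := lam_posimod X Z; lia.
Qed.

(** Apart from [Z], whatever is new in the family is lower than some old node that crosses [Z]. This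
    bounds the width and controls the high pairs. *)
Lemma uncrossed_cases W : W \in T' ->
  [\/ W \in T /\ ~~ crosses W Z, W = Z |
   exists X, [/\ X \in T, crosses X Z & lam W < lam X]].
Proof.
move=> /uncrossedP[W0 [X XT h]].
have [c|nc] := boolP (crosses X Z).
  constructor 3; exists X; split=> //.
  case: h => [->|[d ->]|[d ->]].
  - by have [h|h] := crosses_BVdisjoint treeT BT BZ XT c;
      [case: (lam_crossedI_U XT c h) | case: (lam_crossedI_D XT c h)].
  - by case: (lam_crossedI_D XT c d).
  by case: (lam_crossedI_U XT c d).
suff [->|->] : W = Z \/ W = X; [by constructor 2|by constructor 1|].
move: nc; rewrite /crosses !negb_and !negbK => /or3P[d|s|s].
- case: h => [E|[_ E]|[BX E]].
  + by case: W0; rewrite E; apply/eqP; rewrite setI_eq0.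
  + by right; rewrite E; apply/setDidPl.
  by have := T0 BT; move: (disjoint_sub BX BZ d); rewrite -setI_eq0 setIid => /eqP.
- case: h => [E|[_ E]|[BX E]].
  + by right; rewrite E; apply/setIidPl.
  + by case: W0; rewrite E; apply/eqP; rewrite setD_eq0.
  by left; rewrite E; apply/setUidPr.
case: h => [E|[dB E]|[BX E]].
+ by left; rewrite E; apply/setIidPr.
+ by have := T0 BT; move: (disjointWl (subset_trans BZ s) dB); rewrite -setI_eq0 setIid => /eqP.
by right; rewrite E; apply/setUidPl.
Qed.

Lemma uncrossed_lam K W : (forall X, X \in T -> lam X <= K) -> W \in T' -> lam W <= K.
Proof.
move=> hK /uncrossed_cases[[WT _]|->|[X [XT _ h]]].
- exact: hK.
- by rewrite ltnW // (leq_trans (lamZ BT _ _)) // ?hK // (subset_trans BZ).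
exact: leq_trans (ltnW h) (hK _ XT).
Qed.

(** From level [w0] on no new node is high: [Z] is below [(lam Z).+1], and any other new node is
    strictly below a crossing node, hence below [c0]. *)
Let c0 := \max_(X in T | crosses X Z) lam X.
Let w0 := maxn (lam Z).+1 c0.

Lemma high_pairs_uncrossed_T w U U' : w0 <= w -> (U, U') \in high_pairs T' w ->
  [/\ U \in T, ~~ crosses U Z, U' \in T & ~~ crosses U' Z].
Proof.
move=> ww /high_pairsP[UT UT' UU h].
suff key W : W \in T' -> w <= lam W -> W \in T /\ ~~ crosses W Z.
  by have [||] := key U => //; [apply: h | have [||] := key U' => //; apply: h].
case/uncrossed_cases => [//|->|[X [XT cX hX]]] hw.
  by move: ww; rewrite leqNgt => /negP[]; rewrite (leq_ltn_trans hw) // leq_max leqnn.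
move: ww; rewrite leqNgt => /negP[]; rewrite (leq_ltn_trans hw) // leq_max.
by apply/orP; right; apply: leq_trans hX _; apply: leq_bigmax_cond; rewrite XT.
Qed.

Lemma high_pairs_uncrossed w : w0 <= w -> high_pairs T' w \subset high_pairs T w.
Proof.
move=> ww; apply/subsetP => -[U U'] hp.
have [UT cU UT' cU'] := high_pairs_uncrossed_T ww hp.
have /high_pairsP[_ _ UU h] := hp.
apply/high_pairsP; split=> // Y YT UY YU.
have [cY|ncY] := boolP (crosses Y Z); last by apply: h => //; apply: mem_uncrossed_T.
have Yw : lam Y <= w.
  by rewrite (leq_trans _ ww) // leq_max; apply/orP; right; apply: leq_bigmax_cond; rewrite YT.
(* One of the two sets that replace [Y] still lies between [U] and [U']; which one depends on the
   position of [U] relative to [Z]. It is lower than [Y], hence below [w], which is impossible for a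
   high pair. *)
suff [W [WT UW WU hW]] : exists W, [/\ W \in T', U \subset W, W \subset U' & lam W < lam Y].
  exact: leq_trans (h W WT UW WU) (ltnW hW).
have [d1 s1 s2] := and3P cY.
have YB := crosses_BVdisjoint treeT BT BZ YT cY.
move: (cU); rewrite /crosses !negb_and !negbK => /or3P[d|s|s].
- have [BY|dB] := YB.
    exists (Y :|: Z); split; first exact: mem_uncrossedU.
    + exact: subset_trans UY (subsetUl _ _).
    + rewrite subUset YU; move: cU'; rewrite /crosses !negb_and !negbK => /or3P[d'|s'|//].
        by case/negP: d1; apply: disjointWl d'.
      by case/negP: s1; apply: subset_trans s'.
    by case: (lam_crossedI_U YT cY BY).
  exists (Y :\: Z); split.
  + apply: mem_uncrossedD => //; apply/eqP; by rewrite setD_eq0.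
  + by rewrite subsetD UY.
  + exact: subset_trans (subsetDl _ _) YU.
  by case: (lam_crossedI_D YT cY dB).
- exists (Y :&: Z); split.
  + by apply: mem_uncrossedI => //; apply/eqP; rewrite setI_eq0.
  + by rewrite subsetI UY.
  + exact: subset_trans (subsetIl _ _) YU.
  have [BY|dB] := YB; first by case: (lam_crossedI_U YT cY BY).
  by case: (lam_crossedI_D YT cY dB).
by rewrite (subset_trans s UY) in s2.
Qed.

Lemma potential_uncrossed : potential T' < potential T.
Proof.
apply: (@sum_expn_lex (fun w => #|high_pairs T w|) (fun w => #|high_pairs T' w|) _ _ w0).
- by move=> w; rewrite ltnS max_card.
- rewrite ltnS geq_max; apply/andP; split.
    apply: leq_trans (leq_bigmax B); apply: lamZ => //; exact: subset_trans ZA.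
  by apply/bigmax_leqP => X _; apply: leq_bigmax.
- by move=> w ww; apply: subset_leq_card; apply: high_pairs_uncrossed.
apply: proper_card; apply/properP; split; first exact: high_pairs_uncrossed.
(* A pair is lost at level [w0]: if [c0 <= lam Z] it is [(B, A)], now separated by [Z]; otherwise it
   is [(X, X)] for a highest crossing node [X]. *)
have [hc|hc] := leqP c0 (lam Z).
  have -> : w0 = (lam Z).+1 by apply/maxn_idPl; apply: leqW.
  exists (B, A); first by apply/high_pairsP; split=> //; apply: subset_trans ZA.
  apply/negP => /high_pairsP[_ _ _ /(_ Z)].
  by rewrite ltnn => H; have : false by apply: H => //; apply: (mem_uncrossed_Z treeT AT BT).
have E : w0 = c0 by apply/maxn_idPr.
have [X /andP[XT cX] EX] : exists2 X, (X \in T) && crosses X Z & c0 = lam X.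
  have n0 : 0 < #|[pred X in T | crosses X Z]|.
    rewrite lt0n; apply/eqP => /card0_eq H.
    by move: hc; rewrite /c0 big_pred0 // => X; apply: H.
  by have [X XT EX] := eq_bigmax_cond lam n0; exists X.
exists (X, X).
  apply/high_pairsP; split=> // W WT XW WX; suff -> : W = X by rewrite E EX.
  by apply/eqP; rewrite eqEsubset XW WX.
by apply/negP => /(high_pairs_uncrossed_T (leqnn _))[_]; rewrite cX.
Qed.
End Step.

(* The tree minimizing the potential is linked: otherwise uncross it with a
   separating set of least [lam], among those with the one crossing fewest nodes. *)
Lemma linked_tree_family T K : tree_family T -> (forall X, X \in T -> lam X <= K) ->
  exists T1, [/\ tree_family T1, forall X, X \in T1 -> lam X <= K & linked_family T1].
Proof.
elim/ltn_ind: {T}(potential T) {-2}T (erefl (potential T)) => n IH T Tn treeT lamK.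
have [lk|nlk] := classic (linked_family T); first by exists T.
have [A [B [Z0 [AT BT BZ0 ZA0 H0]]]] : exists A B Z, [/\ A \in T, B \in T, B \subset Z, Z
  \subset A &
    forall Y, Y \in T -> B \subset Y -> Y \subset A -> lam Z < lam Y].
  apply: NNPP => H; apply: nlk => A B Z AT BT BZ ZA; apply: NNPP => H'.
  apply: H; exists A, B, Z; split=> // Y YT BY YA; rewrite ltnNge; apply/negP => h.
  by apply: H'; exists Y.
pose ncross W := #|[set X in T | crosses X W]|.
pose P W := (B \subset W) && (W \subset A).
(* As [ncross W] is at most [#|T|], one number encodes the lexicographic order on [lam] and
   [ncross]. *)
have [Z /andP[BZ ZA] Zm] := arg_minnP (fun W => lam W * #|T|.+1 + ncross W) (introT andP (conj
  BZ0 ZA0) : P Z0).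
have ncT W : ncross W < #|T|.+1.
  by rewrite ltnS subset_leq_card //; apply/subsetP => X; rewrite inE => /andP[].
have Zmin W : B \subset W -> W \subset A -> lam Z <= lam W.
  move=> BW WA; rewrite leqNgt; apply/negP => h.
  have := Zm W (introT andP (conj BW WA)); have := ncT W; have := ncT Z.
  have := leq_mul h (leqnn #|T|.+1); rewrite mulSn; lia.
have Zcr W : B \subset W -> W \subset A -> ncross W < ncross Z -> lam Z < lam W.
  move=> BW WA h; rewrite ltn_neqAle Zmin // andbT; apply/eqP => E.
  by have := Zm W (introT andP (conj BW WA)); rewrite E; lia.
have lamZ Y : Y \in T -> B \subset Y -> Y \subset A -> lam Z < lam Y.
  by move=> YT BY YA; apply: leq_ltn_trans (H0 Y YT BY YA); apply: Zmin.
apply: (IH (potential (uncrossed_family T B Z))) (erefl _) _ _.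
- by rewrite -Tn; apply: (potential_uncrossed treeT AT BT BZ ZA lamZ Zcr).
- exact: (uncrossed_tree treeT AT BT).
by move=> X; apply: (uncrossed_lam treeT AT BT BZ ZA lamZ Zcr).
Qed.
End Linked.
End TreeFamilies.

(** * From branch-decompositions to tree families *)

Section Decomposable.
Variables (V : finType) (lam : {set V} -> nat) (K : nat).
Implicit Types X Y : {set V}.

(** What remains of a rooted branch-decomposition when only the sides of its edges are kept;
    vertices of degree 2 disappear. *)
Inductive decomposable : {set V} -> Prop :=
| Decomposable1 x : lam [set x] <= K -> decomposable [set x]
| DecomposableU X Y : decomposable X -> decomposable Y -> [disjoint X & Y] ->
    lam (X :|: Y) <= K -> decomposable (X :|: Y).

Lemma splittable_mono (T T' : {set {set V}}) X : T \subset T' -> splittable T X -> splittable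
  T' X.
Proof.
move=> /subsetP TT' [|[X1 [X2 [h1 h2 h3 h4]]]]; first by left.
by right; exists X1, X2; split=> //; apply: TT'.
Qed.

Lemma decomposable_family X : decomposable X -> exists T : {set {set V}},
  [/\ X \in T, set0 \notin T, laminar T, forall Y, Y \in T -> splittable T Y &
      forall Y, Y \in T -> Y \subset X /\ lam Y <= K].
Proof.
elim=> {X} [x hx|X Y _ [T1 [X1 n1 l1 s1 h1]] _ [T2 [Y2 n2 l2 s2 h2]] d hK].
  exists [set [set x]]; split.
  - by rewrite set11.
  - by rewrite inE eq_sym; apply/set0Pn; exists x; rewrite set11.
  - by move=> X Y; rewrite !inE => /eqP -> /eqP ->; left.
  - by move=> Y; rewrite inE => /eqP ->; left; rewrite cards1.
  by move=> Y; rewrite inE => /eqP ->.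
have XY0 : X :|: Y != set0.
  by apply: contra n1; rewrite setU_eq0 => /andP[/eqP <-].
exists ((X :|: Y) |: (T1 :|: T2)); split.
- by rewrite setU11.
- by rewrite !inE eq_sym (negPf XY0) (negPf n1) (negPf n2).
- have sub Z : Z \in (X :|: Y) |: (T1 :|: T2) -> Z \subset X :|: Y.
    rewrite !inE => /or3P[/eqP -> //|/h1[ZX _]|/h2[ZY _]].
      exact: subset_trans ZX (subsetUl _ _).
    exact: subset_trans ZY (subsetUr _ _).
  move=> A B AT BT; move: (AT) (BT).
  rewrite !inE => /or3P[/eqP ->|A1|A2] /or3P[/eqP ->|B1|B2].
  + by left.
  + by right; left; apply: sub.
  + by right; left; apply: sub.
  + by left; apply: sub.
  + exact: l1.
  + by right; right; apply: disjoint_sub d; [case: (h1 A) | case: (h2 B)].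
  + by left; apply: sub.
  + by right; right; rewrite disjoint_sym; apply: disjoint_sub d; [case: (h1 B) | case: (h2 A)].
  exact: l2.
- move=> Z; rewrite !inE => /or3P[/eqP ->|Z1|Z2].
  + by right; exists X, Y; split=> //; rewrite !inE ?X1 ?Y2 ?orbT.
  + by apply: splittable_mono (s1 _ Z1); apply/subsetP => W W1; rewrite !inE W1 orbT.
  by apply: splittable_mono (s2 _ Z2); apply/subsetP => W W1; rewrite !inE W1 !orbT.
move=> Z; rewrite !inE => /or3P[/eqP ->|/h1[s k]|/h2[s k]]; split=> //.
  exact: subset_trans s (subsetUl _ _).
exact: subset_trans s (subsetUr _ _).
Qed.

Lemma decomposable_tree_family : decomposable setT ->
  exists2 T, tree_family T & forall X, X \in T -> lam X <= K.
Proof.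
move=> /decomposable_family[T [h1 h2 h3 h4 h5]]; exists T; first by split.
by move=> X /h5[].
Qed.
End Decomposable.

(** * The two sides of an edge of a tree *)

Section TreeSides.
Variables (T : finType) (e : rel T).
Hypotheses (e_sym : symmetric e) (e_irr : irreflexive e).
Hypothesis e_acyclic : forall c : seq T, ucycle e c -> size c <= 2.

Definition avoid z : rel T := [rel a b | [&& e a b, a != z & b != z]].
Definition component z y := [set v | connect (avoid z) y v].

Lemma avoid_connect_sym z : connect_sym (avoid z).
Proof. by apply: sym_connect_sym => a b; rewrite /avoid /= e_sym [(_ != _) && _]andbC. Qed.

Lemma path_avoid z y p : y != z -> path (avoid z) y p = path e y p && (z \notin p).
Proof.
elim: p y => //= a p IH y yz; rewrite {1}/avoid /= yz /=.
have [->|az] := eqVneq a z; first by rewrite !andbF inE eqxx andbF.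
by rewrite IH // inE eq_sym (negPf az) /= andbT andbA.
Qed.

Lemma edge_neq a b : e a b -> a != b.
Proof. by apply: contraTneq => ->; rewrite e_irr. Qed.

Lemma uniq_pathP (r : rel T) x y : connect r x y ->
  exists p, [/\ path r x p, y = last x p & uniq (x :: p)].
Proof. by case/connectP => p hp ->; case: (shortenP hp) => p' h1 h2 _; exists p'. Qed.

(** Acyclicity enters here: for distinct [a] and [b], a path between them that avoids [z] closes
    through [z] into a cycle of length at least 3. *)
Lemma connect_avoid_neighbours z a b : e z a -> e z b -> connect (avoid z) a b -> a = b.
Proof.
move=> za zb /uniq_pathP[p [hp E up]]; apply/eqP/negPn/negP => ab.
have az : a != z by rewrite eq_sym edge_neq.
move: hp; rewrite path_avoid // => /andP[hp zp].
have p0 : p != [::] by apply: contraNneq ab => p0; rewrite E p0.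
suff /e_acyclic : ucycle e [:: z, a & p] by case: (p) p0.
rewrite /ucycle /= rcons_path hp za -E e_sym zb /= inE negb_or eq_sym az zp /=.
by move: up => /= ->.
Qed.

(** Trades the removed edge for a removed vertex, which makes the recursion of [componentP] over the
    neighbors available. Reaching [t'] from [t] without their edge would close a cycle. *)
Lemma connect_remove_edge t t' z : e t t' ->
  connect (remove_edge e t t') t z = (z \in component t' t).
Proof.
move=> tt'; have ne := edge_neq tt'; rewrite inE.
apply/idP/idP; last first.
  apply: connect_sub => a b /and3P[ab at' bt']; apply: connect1.
  by rewrite /remove_edge ab !xpair_eqE (negPf at') (negPf bt') andbF.
move=> /uniq_pathP[p [hp -> up]]; apply/connectP; exists p => //.
have he : subrel (remove_edge e t t') e by move=> a b /and3P[].
rewrite path_avoid // (sub_path he hp) /=; apply/negP => t'p.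
case/splitPr: t'p hp up => p1 p2; rewrite cat_path => /andP[h1 /= /andP[h2 _]].
rewrite -/(uniq (t :: p1 ++ t' :: p2)) -cat_cons cat_uniq => /and3P[u1 /norP[n1 _] _].
have E : t = last t p1.
  apply: (@connect_avoid_neighbours t'); [by rewrite e_sym | by rewrite e_sym; case/and3P: h2 |].
  apply/connectP; exists p1 => //; rewrite path_avoid // (sub_path he h1) /=.
  by apply: contra n1; rewrite inE => ->; rewrite orbT.
case: p1 E u1 h2 {h1 n1} => [|a p1] /= E; first by rewrite /remove_edge eqxx andbF.
by rewrite {1}E mem_last.
Qed.

Lemma component_notin t y : y != t -> t \notin component t y.
Proof.
move=> yt; rewrite inE; apply/negP => /connectP[p]; rewrite path_avoid // => /andP[_ tp] E.
by move: (mem_last y p); rewrite -E inE (negPf tp) eq_sym (negPf yt).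
Qed.

Lemma component_disjoint t a b : e t a -> e t b -> a != b -> [disjoint component t a &
  component t b].
Proof.
move=> ta tb; apply: contraR => /disjoint_nP[v]; rewrite !inE => h1 h2.
apply/eqP/(connect_avoid_neighbours ta tb); apply: connect_trans h1 _.
by rewrite avoid_connect_sym.
Qed.

Lemma componentP t t' v : e t t' ->
  reflect (v = t \/ exists y, [/\ e t y, y != t' & v \in component t y]) (v \in component t' t).
Proof.
move=> tt'; have ne := edge_neq tt'; rewrite inE.
apply: (iffP idP) => [/uniq_pathP[[|y p] [hp E up]]|[->|[y [ty yt']]]].
- by left.
- right; exists y; move: hp; rewrite path_avoid //= inE negb_or.
  case/andP => /andP[ty hp] /andP[t'y t'p]; split; rewrite 1?eq_sym // inE.
  apply/connectP; exists p => //; rewrite path_avoid 1?eq_sym ?edge_neq // hp /=.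
  by move: up => /=; rewrite inE negb_or => /andP[/andP[]].
- exact: connect0.
have yt : y != t by rewrite eq_sym edge_neq.
rewrite inE => /connectP[p hp E].
apply: (@connect_trans _ _ y); first by apply: connect1; rewrite /avoid /= ty ne yt'.
apply/connectP; exists p => //; rewrite path_avoid //.
move: (hp); rewrite path_avoid // => /andP[-> _] /=.
apply: contra yt' => t'p; apply/eqP; apply: (connect_avoid_neighbours ty tt').
case/splitPr: t'p hp {E} => p1 p2; rewrite cat_path => /andP[h1 /= /andP[h2 _]].
by apply/connectP; exists (rcons p1 t'); rewrite ?last_rcons // rcons_path h1.
Qed.

Lemma component_cover t t' v : e t t' -> connect e t v -> v \in component t' t :|: component t t'.
Proof.
move=> tt' /uniq_pathP[[|y p] [hp E up]]; rewrite inE.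
  by apply/orP; left; apply/(componentP _ tt'); left.
move: hp => /= /andP[ty hp].
have vy : v \in component t y.
  rewrite inE; apply/connectP; exists p => //; rewrite path_avoid 1?eq_sym ?edge_neq // hp /=.
  by move: up => /=; rewrite inE negb_or => /andP[/andP[]].
have [<-|yt'] := eqVneq y t'; first by rewrite vy orbT.
by apply/orP; left; apply/(componentP _ tt'); right; exists y.
Qed.

Lemma component_disjoint_edge t t' : e t t' -> [disjoint component t' t & component t t'].
Proof.
move=> tt'; apply/negPn/negP => /disjoint_nP[v /(componentP _ tt')[->|[y [ty yt' vy]]] h].
  have t't : t' != t by rewrite eq_sym edge_neq.
  by have := component_notin t't; rewrite h.
by have := component_disjoint ty tt' yt'; move/disjointFr => /(_ v vy); rewrite h.
Qed.
End TreeSides.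

Section BranchDecomposition.
Variables (V : finType) (D : branch_decomposition V) (lam : {set V} -> nat) (K : nat).
Hypothesis lamK : forall t t', bd_adj (b := D) t t' -> lam (bd_side t t') <= K.
Hypothesis lamT : lam setT <= K.
Local Notation e := (@bd_adj _ D).

Lemma bd_side_decomposable t t' : e t t' -> decomposable lam K (bd_side t t').
Proof.
have [_ e_sym e_irr e_conn e_acy] := bd_tree D.
have sideE t1 t2 : e t1 t2 -> forall v, (v \in bd_side t1 t2) = (val (bd_leaf D v) \in
  component e t2 t1).
  by move=> h v; rewrite inE connect_remove_edge.
elim/ltn_ind: {t t'}(#|component e t' t|) {-2}t {-2}t' (erefl #|component e t' t|) => n IH t t'
  En tt'.
have lt_n y : e t y -> y != t' -> #|component e t y| < n.
  move=> ty yt'; rewrite -En; apply: proper_card; apply/properP; split.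
    by apply/subsetP => v vy; apply/(componentP e_sym e_irr e_acy _ tt'); right; exists y.
  exists t; first by apply/(componentP e_sym e_irr e_acy _ tt'); left.
  by apply: component_notin => //; rewrite eq_sym; apply: edge_neq.
have nbrs y : (y \in [set y | e t y] :\ t') = e t y && (y != t') by rewrite !inE andbC.
have degE : degree e t = #|[set y | e t y] :\ t'|.+1.
  by rewrite /degree (cardsD1 t') inE tt'.
have := bd_subcubic t; rewrite degE.
(* The neighbors of [t] other than [t']: with none, [t] is a leaf and the side a singleton; with
   one, the side is that of the neighbor, as [t] is not a leaf; with two, it is a disjoint union. *)
case Ec : #|_ :\ _| => [|[|[|//]]] _.
- have tl : leaf e t by rewrite /leaf degE Ec.
  have [g gK Kg] := bd_leaf_bij D.
  have E : bd_side t t' = [set g (Sub t tl)].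
    apply/setP => v; rewrite sideE // inE.
    apply/(componentP e_sym e_irr e_acy _ tt')/eqP => [[vt|[y [ty yt' _]]]|->].
    + by rewrite -(gK v); congr g; apply: val_inj.
    + by move: (nbrs y); rewrite ty yt' (cards0_eq Ec) inE.
    by left; rewrite Kg.
  by rewrite E; apply: Decomposable1; rewrite -E; apply: lamK.
- move/eqP/cards1P: (Ec) => [y Ey].
  have /andP[ty yt'] : e t y && (y != t') by rewrite -nbrs Ey set11.
  suff -> : bd_side t t' = bd_side y t.
    by apply: (IH _ (lt_n y ty yt')); rewrite // e_sym.
  apply/setP => v; rewrite !sideE // 1?e_sym //.
  apply/(componentP e_sym e_irr e_acy _ tt')/idP => [[vt|[z [tz zt' h]]]|h].
  + by have := valP (bd_leaf D v); rewrite /= vt /leaf degE Ec.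
  + by move: (nbrs z); rewrite tz zt' Ey inE => /eqP <-.
  by right; exists y.
move/eqP/cards2P: (Ec) => [y [z [yz Ey]]].
have /andP[ty yt'] : e t y && (y != t') by rewrite -nbrs Ey !inE eqxx.
have /andP[tz zt'] : e t z && (z != t') by rewrite -nbrs Ey !inE eqxx orbT.
have E : bd_side t t' = bd_side y t :|: bd_side z t.
  apply/setP => v; rewrite in_setU !sideE // 1?e_sym //.
  apply/(componentP e_sym e_irr e_acy _ tt')/orP => [[vt|[x [tx xt' h]]]|[h|h]].
  + by have := valP (bd_leaf D v); rewrite /= vt /leaf degE Ec.
  + by move: (nbrs x); rewrite tx xt' Ey in_set2 => /orP[] /eqP <-; [left|right].
  + by right; exists y.
  by right; exists z.
rewrite E; apply: DecomposableU.
- by apply: (IH _ (lt_n y ty yt')); rewrite // e_sym.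
- by apply: (IH _ (lt_n z tz zt')); rewrite // e_sym.
- apply/negPn/negP => /disjoint_nP[v]; rewrite !sideE // 1?e_sym // => h1 h2.
  have := component_disjoint e_sym e_irr e_acy ty tz yz.
  by move/disjointFr => /(_ _ h1); rewrite h2.
by rewrite -E; apply: lamK.
Qed.

Lemma bd_decomposable : 0 < #|V| -> decomposable lam K setT.
Proof.
move=> /card_gt0P[v0 _].
have [_ e_sym e_irr e_conn e_acy] := bd_tree D.
pose t := val (bd_leaf D v0).
have /card_gt0P[t'] : 0 < #|[set y | e t y]| by have := valP (bd_leaf D v0); rewrite /= /leaf
  /degree => /eqP ->.
rewrite inE => tt'.
have E : setT = bd_side t t' :|: bd_side t' t.
  apply/setP => v; rewrite !inE !connect_remove_edge // 1?e_sym //.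
  by have := component_cover e_sym e_irr e_acy tt' (e_conn t (val (bd_leaf D v))); rewrite
    in_setU => ->.
rewrite E; apply: DecomposableU; try by apply: bd_side_decomposable; rewrite // e_sym.
  apply/negPn/negP => /disjoint_nP[v]; rewrite !inE !connect_remove_edge // 1?e_sym // => h1 h2.
  by have := component_disjoint_edge e_sym e_irr e_acy tt'; move/disjointFr => /(_ _ h1);
    rewrite h2.
by rewrite -E.
Qed.
End BranchDecomposition.

Import Order.TTheory GRing.Theory Num.Theory.
Local Open Scope ring_scope.

(** * Lagrangian chain-groups and linking *)

Lemma ord2E (i : 'I_2) : i = 0 \/ i = 1.
Proof. by case: i => -[|[|//]] hi; [left | right]; apply: val_inj. Qed.

Section ChainSpaces.
Variables (F : finFieldType) (V : finType).
Local Notation C := (chain F V).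
Implicit Types (N S T : {vspace C}) (f g h : C) (U W A B Z : {set V}).

(** Over a finite field the chains form a finite type, so a linear boolean predicate can be turned
    into the subspace it defines. *)
Definition vspace_of (P : pred C) : {vspace C} := <<enum P>>%VS.

Lemma mem_vspace_of (P : pred C) : P 0 ->
  (forall a f g, P f -> P g -> P (a *: f + g)) -> forall f, (f \in vspace_of P) = P f.
Proof.
move=> P0 Pl f; apply/idP/idP => [|Pf]; last by apply: memv_span; rewrite mem_enum.
rewrite /vspace_of => /(@coord_span _ _ _ (in_tuple (enum P))) ->.
apply: (big_ind (fun u => P u)) => // [u v Pu Pv|i _]; first by rewrite -[u]scale1r; apply: Pl.
rewrite -[X in P X]addr0; apply: Pl => //.
have : (enum P)`_i \in enum P by apply: mem_nth.
by rewrite mem_enum.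
Qed.

Definition proj U f : C := [ffun x => if x \in U then f x else 0].
Lemma proj_is_linear U : linear (proj U).
Proof. by move=> a f g; apply/ffunP => x; rewrite !ffunE; case: ifP; rewrite // scaler0 addr0.
  Qed.
HB.instance Definition _ U := GRing.isLinear.Build F C C _ (proj U) (@proj_is_linear U).

Definition entry x (b : 'I_2) f : F^o := f x b 0.
Lemma entry_is_linear x b : linear (entry x b).
Proof. by move=> a f g; rewrite /entry !ffunE !mxE. Qed.
HB.instance Definition _ x b := GRing.isLinear.Build F C F^o _ (entry x b) (@entry_is_linear x b).

Definition supported U f := [forall x, (x \notin U) ==> (f x == 0)].
Lemma supportedP U f : reflect (forall x, x \notin U -> f x = 0) (supported U f).
Proof.
apply: (iffP forallP) => h x; first by move=> xU; move: (h x); rewrite xU => /eqP.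
by apply/implyP => /h ->.
Qed.

Lemma proj_supported U f : supported U f -> proj U f = f.
Proof. by move=> /supportedP h; apply/ffunP => x; rewrite ffunE; case: ifPn => // /h. Qed.

Lemma supported_proj U f : supported U (proj U f).
Proof. by apply/supportedP => x /negPf xU; rewrite ffunE xU. Qed.

(** In contrast with [cross], the chains stay on all of [V], so that the spaces for different [U]
    can be intersected and added. *)
Definition crossv N U := vspace_of [pred f | (f \in N) && supported U f].
Lemma mem_crossv N U f : (f \in crossv N U) = (f \in N) && supported U f.
Proof.
rewrite /crossv mem_vspace_of //= => [|a {}f g].
  by rewrite mem0v; apply/supportedP => x _; rewrite ffunE.
move=> /andP[fN /supportedP fU] /andP[gN /supportedP gU]; rewrite memvD ?memvZ //=.
by apply/supportedP => x xU; rewrite !ffunE fU // gU // scaler0 addr0.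
Qed.

Lemma crossv_sub N U : (crossv N U <= N)%VS.
Proof. by apply/subvP => f; rewrite mem_crossv => /andP[]. Qed.

Lemma crossvS N U W : U \subset W -> (crossv N U <= crossv N W)%VS.
Proof.
move=> UW; apply/subvP => f; rewrite !mem_crossv => /andP[-> /supportedP fU] /=.
by apply/supportedP => x xW; apply: fU; apply: contra xW; apply: (subsetP UW).
Qed.

Lemma crossvI N U W : crossv N (U :&: W) = (crossv N U :&: crossv N W)%VS.
Proof.
apply/vspaceP => f; rewrite memv_cap !mem_crossv.
case: (f \in N) => //=; apply/supportedP/andP => [h|[/supportedP hU /supportedP hW] x].
  by split; apply/supportedP => x xU; apply: h; rewrite inE (negPf xU) ?andbF.
by rewrite inE negb_and => /orP[/hU|/hW].
Qed.

Lemma dim_crossv_supermod N U W :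
  (\dim (crossv N U) + \dim (crossv N W) <= \dim (crossv N (U :&: W)) + \dim (crossv N (U :|:
    W)))%N.
Proof.
rewrite -dimv_sum_cap crossvI addnC leq_add2l dimvS // subv_add.
by apply/andP; split; apply: crossvS; [exact: subsetUl | exact: subsetUr].
Qed.

Lemma dim_proj N U : (\dim (crossv N (~: U)) + \dim (linfun (proj U) @: N) = \dim N)%N.
Proof.
rewrite -[RHS](limg_ker_dim (linfun (proj U)) N); congr (\dim _ + _)%N.
apply/vspaceP => f; rewrite mem_crossv memv_cap memv_ker lfunE /=; congr (_ && _).
apply/supportedP/eqP => [h|/ffunP h x].
  apply/ffunP => x; rewrite !ffunE; case: ifP => // xU; apply: h.
  by rewrite inE xU.
by rewrite inE negbK => xU; move: (h x); rewrite !ffunE xU.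
Qed.

(** * Orthogonality and the connectivity of Lagrangian chain-groups *)

Section Form.
Variable s : form_type.

Lemma chain_form_supported U f g : supported U f -> chain_form s f (proj U g) = chain_form s f g.
Proof.
move=> /supportedP fU; apply: eq_bigr => x _; rewrite !ffunE; case: ifPn => // xU.
by rewrite fU // /formK; case: s; rewrite !mxE ?mul0r ?addr0 ?subr0.
Qed.

Definition twist (v : 'cV[F]_2) (i : 'I_2) : F :=
  if i == 0 then v 1 0 else (if s is Symmetric then v 0 0 else - v 0 0).

Lemma formKE u v : formK s u v = \sum_(i < 2) u i 0 * twist v i.
Proof.
rewrite big_ord_recl big_ord1 /twist /formK; case: s => //=; congr (_ + _) => //.
  by rewrite (_ : lift _ _ = 1) //; apply: val_inj.
by rewrite (_ : lift _ _ = 1) ?mulrN //; apply: val_inj.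
Qed.

Section OrthDim.
Variables (U : {set V}).
Let I := setX U [set: 'I_2].
Let n := #|I|.
Let phi f : 'rV[F]_n := \row_i f (enum_val i).1 (enum_val i).2 0.
Let psi f : 'rV[F]_n := \row_i twist (f (enum_val i).1) (enum_val i).2.

Let phi_lin : linear phi.
Proof. by move=> a f g; apply/rowP => i; rewrite !mxE !ffunE !mxE. Qed.

Let psi_lin : linear psi.
Proof.
move=> a f g; apply/rowP => i; rewrite !mxE /twist !ffunE !mxE.
by case: ifP => // _; case: s; rewrite // opprD mulrN.
Qed.

Let phi_inj f : supported U f -> phi f = 0 -> f = 0.
Proof.
move=> /supportedP fU /rowP h; apply/ffunP => x; rewrite ffunE.
have [xU|/fU //] := boolP (x \in U); apply/matrixP => i j; rewrite ord1 mxE.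
have xiI : (x, i) \in I by rewrite !inE xU.
by have := h (enum_rank_in xiI (x, i)); rewrite !mxE enum_rankK_in.
Qed.

Let psi_inj f : supported U f -> psi f = 0 -> f = 0.
Proof.
move=> /supportedP fU /rowP h; apply/ffunP => x; rewrite ffunE.
have [xU|/fU //] := boolP (x \in U).
have H i : twist (f x) i = 0.
  have xiI : (x, i) \in I by rewrite !inE xU.
  by have := h (enum_rank_in xiI (x, i)); rewrite !mxE enum_rankK_in.
apply/matrixP => i j; rewrite ord1 mxE.
have := H 0; have := H 1; rewrite /twist /=.
have [->|->] := ord2E i => [h0 _|_ h1 //].
by move: h0; case: s => [//|/eqP]; rewrite oppr_eq0 => /eqP.
Qed.

Let rank_basis S (xi : C -> 'rV[F]_n) : linear xi ->
  (forall f, f \in S -> xi f = 0 -> f = 0) ->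
  \rank (\matrix_(i < \dim S) xi (vbasis S)`_i) = \dim S.
Proof.
move=> lin inj.
pose x := GRing.isLinear.Build F C 'rV[F]_n _ xi lin.
pose xl : {linear C -> 'rV[F]_n} := HB.pack xi x.
apply/eqP; rewrite -[_ == _]/(row_free _); apply: inj_row_free => v.
have -> : v *m (\matrix_(i < \dim S) xi (vbasis S)`_i) = xl (\sum_i v 0 i *: (vbasis S)`_i).
  rewrite linear_sum; apply/rowP => j; rewrite !mxE summxE; apply: eq_bigr => i _.
  by rewrite linearZ !mxE.
move=> /inj H; have {}H : \sum_i v 0 i *: (vbasis S)`_i = 0.
  by apply: H; apply: memv_suml => i _; rewrite memvZ // vbasis_mem // mem_nth ?size_tuple.
apply/rowP => i; rewrite mxE.
by have /freeP := basis_free (vbasisP S); apply.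
Qed.

(** Nondegeneracy of the form on [U]: twisting the second argument makes it a dot product, and
    orthogonality becomes [A *m B^T = 0] for two matrices of full row rank with [2 * #|U|]
    columns. *)
Lemma orth_dim S T : (forall f, f \in S -> supported U f) -> (forall f, f \in T -> supported U
  f) ->
  (forall f g, f \in S -> g \in T -> chain_form s f g = 0) ->
  (\dim S + \dim T <= 2 * #|U|)%N.
Proof.
move=> SU TU ST.
pose A := \matrix_(i < \dim S) phi (vbasis S)`_i.
pose B := \matrix_(i < \dim T) psi (vbasis T)`_i.
have bS (i : 'I_(\dim S)) : (vbasis S)`_i \in S by apply: vbasis_mem; rewrite mem_nth ?size_tuple.
have bT (i : 'I_(\dim T)) : (vbasis T)`_i \in T by apply: vbasis_mem; rewrite mem_nth ?size_tuple.
have AB : A *m B^T = 0.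
  apply/matrixP => i j; rewrite !mxE -[RHS](ST _ _ (bS i) (bT j)).
  transitivity (\sum_(p in I) (vbasis S)`_i p.1 p.2 0 * twist ((vbasis T)`_j p.1) p.2).
    by rewrite [RHS]big_enum_val; apply: eq_bigr => k _; rewrite !mxE.
  rewrite (eq_bigl (fun p => (p.1 \in U) && true)); last by move=> p; rewrite !inE !andbT.
  rewrite -(pair_big (fun x => x \in U) predT (fun x k => (vbasis S)`_i x k 0 * twist ((vbasis
    T)`_j x) k)) /=.
  rewrite /chain_form [RHS](bigID (mem U)) /= [X in _ = _ + X]big1 ?addr0.
    by apply: eq_bigr => x _; rewrite formKE.
  move=> x xU; have /supportedP -> := SU _ (bS i) => //.
  by rewrite formKE big1 // => k _; rewrite mxE mul0r.
have := mulmx0_rank_max AB; rewrite mxrank_tr !rank_basis //.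
- by rewrite /n /I cardsX cardsT card_ord mulnC.
- by move=> f /TU; apply: psi_inj.
by move=> f /SU; apply: phi_inj.
Qed.
End OrthDim.

Definition lagrangian N :=
  (forall f g, f \in N -> g \in N -> chain_form s f g = 0) /\ \dim N = #|V|.

Lemma dim_isotropic_crossv N U : (forall f g, f \in N -> g \in N -> chain_form s f g = 0) ->
  (\dim (crossv N U) <= #|U|)%N.
Proof.
move=> iso; have := @orth_dim U (crossv N U) (crossv N U).
rewrite addnn -mul2n leq_pmul2l //; apply.
- by move=> f; rewrite mem_crossv => /andP[].
- by move=> f; rewrite mem_crossv => /andP[].
by move=> f g; rewrite !mem_crossv => /andP[fN _] /andP[gN _]; apply: iso.
Qed.

(** Isotropy makes [crossv N W] orthogonal to the projection of [N] on [W], which bounds the sum of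
    their dimensions by [2 * #|W|]. For [U] and its complement these bounds add up to [2 * \dim N],
    the actual total, so both are equalities. *)
Lemma dim_lagrangian_crossvC N U : lagrangian N ->
  (\dim (crossv N (~: U)) + 2 * #|U| = #|V| + \dim (crossv N U))%N.
Proof.
case=> iso dimN.
have ineq W : (\dim (crossv N W) + \dim (linfun (proj W) @: N) <= 2 * #|W|)%N.
  apply: orth_dim.
  - by move=> f; rewrite mem_crossv => /andP[].
  - by move=> f /memv_imgP[g _ ->]; rewrite lfunE; apply: supported_proj.
  move=> f g; rewrite mem_crossv => /andP[fN fW] /memv_imgP[{}g gN ->].
  by rewrite lfunE /= chain_form_supported // iso.
have h1 := ineq U; have h2 := ineq (~: U).
have e1 := dim_proj N U; have e2 := dim_proj N (~: U); rewrite setCK in e2.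
have e3 := cardsC U; rewrite dimN in e1 e2.
move: h1 h2 e1 e2 e3; lia.
Qed.

Definition conn N U := (#|U| - \dim (crossv N U))%N.

Section Lagrangian.
Variable N : {vspace C}.
Hypothesis lagN : lagrangian N.

Lemma connE U : (conn N U + \dim (crossv N U) = #|U|)%N.
Proof. by rewrite subnK // dim_isotropic_crossv //; case: lagN. Qed.

Lemma connC U : conn N (~: U) = conn N U.
Proof.
have := dim_lagrangian_crossvC U lagN; have := connE U; have := connE (~: U).
have := cardsC U; lia.
Qed.

Lemma conn_submod U W : (conn N (U :&: W) + conn N (U :|: W) <= conn N U + conn N W)%N.
Proof.
have := dim_crossv_supermod N U W; have := cardsUI U W.
have := connE U; have := connE W; have := connE (U :&: W); have := connE (U :|: W); lia.
Qed.

Lemma conn_setT : conn N setT = 0%N.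
Proof.
rewrite /conn; have <- : N = crossv N setT; last by case: lagN => _ ->; rewrite cardsT subnn.
apply/vspaceP => f; rewrite mem_crossv; case: (f \in N) => //=.
by apply/esym/supportedP => x; rewrite inE.
Qed.
End Lagrangian.

(** * Removing elements, and linking *)

Definition delta x (b : 'I_2) : C := [ffun y => if y == x then \col_i (i != b)%:R else 0].

(* Deletion or contraction of [x], but keeping [x] in the ground set, where the
   chains of the result run over the line of vectors with zero [b]-entry. *)
Definition reducev N x (b : 'I_2) := vspace_of [pred h : C | (h x b 0 == 0) &&
  [exists f : C, [&& f \in N, f x b 0 == 0 & [forall y, (y != x) ==> (h y == f y)]]]].

Lemma reducevP N x b h : reflect (h x b 0 = 0 /\
    exists f, [/\ f \in N, f x b 0 = 0 & forall y, y != x -> h y = f y]) (h \in reducev N x b).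
Proof.
have P g : reflect (g x b 0 = 0 /\
    exists f, [/\ f \in N, f x b 0 = 0 & forall y, y != x -> g y = f y])
    ((g x b 0 == 0) && [exists f : C, [&& f \in N, f x b 0 == 0 & [forall y, (y != x) ==> (g y
      == f y)]]]).
  apply: (iffP andP) => [[/eqP gx /existsP[f /and3P[fN /eqP fx /forallP fy]]]|[gx [f [fN fx
    fy]]]].
    by split=> //; exists f; split=> // y yx; move: (fy y); rewrite yx => /eqP.
  split; first exact/eqP; apply/existsP; exists f; rewrite fN fx eqxx /=.
  by apply/forallP => y; apply/implyP => /fy ->.
rewrite mem_vspace_of; first exact: P.
  apply/P; split; first by rewrite ffunE mxE.
  by exists 0; split=> //; [rewrite mem0v | rewrite ffunE mxE].
move=> a g g' /P[gx [f [fN fx fy]]] /P[gx' [f' [fN' fx' fy']]]; apply/P; split.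
  by rewrite !ffunE !mxE gx gx' mulr0 addr0.
exists (a *: f + f'); split; first by rewrite memvD ?memvZ.
  by rewrite !ffunE !mxE fx fx' mulr0 addr0.
by move=> y yx; rewrite !ffunE fy ?fy'.
Qed.

Lemma formK_line (b : 'I_2) (u v : 'cV[F]_2) : u b 0 = 0 -> v b 0 = 0 -> formK s u v = 0.
Proof.
rewrite /formK; have [->|->] := ord2E b => -> ->;
  by case: s; rewrite ?mul0r ?mulr0 ?addr0 ?subr0.
Qed.

Lemma formK_delta x b f : formK s (f x) (delta x b x) = 0 -> f x b 0 = 0.
Proof.
rewrite /formK !ffunE eqxx !mxE; have [->|->] := ord2E b; case: s => /=;
  by rewrite ?mulr1 ?mulr0 ?addr0 ?add0r ?subr0 ?sub0r // => /eqP; rewrite oppr_eq0 => /eqP.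
Qed.

Lemma delta_reducev N x b : delta x b \in reducev N x b.
Proof.
apply/reducevP; split; first by rewrite ffunE eqxx mxE eqxx.
exists 0; split; rewrite ?mem0v // ?ffunE ?mxE // => y yx.
by rewrite !ffunE (negPf yx).
Qed.

(** The condition at [x] costs at most one dimension, which [delta x b] gives back. If [delta x b]
    is already in [N], isotropy forces the condition on all of [N] and nothing is lost. *)
Lemma lagrangian_reducev N x b : lagrangian N -> lagrangian (reducev N x b).
Proof.
case=> iso dimN.
have iso' f g : f \in reducev N x b -> g \in reducev N x b -> chain_form s f g = 0.
  move=> /reducevP[fx [f' [fN fx' fy]]] /reducevP[gx [g' [gN gx' gy]]].
  rewrite -(iso _ _ fN gN); apply: eq_bigr => y _.
  have [->|yx] := eqVneq y x; last by rewrite fy ?gy.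
  by rewrite !(@formK_line b).
split=> //; apply/eqP; rewrite eqn_leq; apply/andP; split.
  have := dim_isotropic_crossv setT iso'; rewrite cardsT.
  apply: leq_trans; apply: dimvS; apply/subvP => f fR; rewrite mem_crossv fR /=.
  by apply/supportedP => y; rewrite inE.
pose Nb := (N :&: lker (linfun (entry x b)))%VS.
have NbR : (Nb <= reducev N x b)%VS.
  apply/subvP => f; rewrite memv_cap memv_ker lfunE => /andP[fN /eqP fx].
  by apply/reducevP; split=> //; exists f.
have dimNb : (#|V| <= \dim Nb + 1)%N.
  rewrite -dimN -(limg_ker_dim (linfun (entry x b)) N) leq_add2l.
  by rewrite (leq_trans (dimvS (subvf _))) // dimvf.
have [dN|dN] := boolP (delta x b \in N).
  rewrite -dimN dimvS //; apply: subv_trans NbR; rewrite subv_cap subvv /=.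
  apply/subvP => f fN; rewrite memv_ker lfunE; apply/eqP; apply: formK_delta.
  rewrite -[RHS](iso _ _ fN dN) /chain_form (bigD1 x) //= big1 ?addr0 // => y yx.
  rewrite [delta x b y]ffunE (negPf yx) /formK; case: s; by rewrite !mxE !mulr0 ?addr0 ?subr0.
apply: leq_trans dimNb _.
have d1 : \dim <[delta x b]>%VS = 1%N.
  rewrite dim_vline; case: eqP => // d0; by rewrite d0 mem0v in dN.
rewrite -[X in (_ + X <= _)%N]d1 -dimv_disjoint_sum; last first.
  apply/eqP; rewrite -subv0; apply/subvP => f; rewrite memv_cap => /andP[].
  rewrite memv_cap => /andP[fN _] /vlineP[a E]; rewrite memv0.
  have [a0|a0] := eqVneq a 0; first by rewrite E a0 scale0r.
  by case/negP: dN; rewrite -[delta x b](scalerK a0) -E memvZ.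
by rewrite dimvS // subv_add NbR -memvE delta_reducev.
Qed.

Definition constrained (b : V -> 'I_2) U f := [forall x in U, f x (b x) 0 == 0].
Lemma constrainedP b U f : reflect (forall x, x \in U -> f x (b x) 0 = 0) (constrained b U f).
Proof.
apply: (iffP forallP) => h x; first by move=> xU; move: (h x); rewrite xU => /eqP.
by apply/implyP => /h ->.
Qed.

Definition constrainv N b U := vspace_of [pred f | (f \in N) && constrained b U f].
Lemma mem_constrainv N b U f : (f \in constrainv N b U) = (f \in N) && constrained b U f.
Proof.
rewrite /constrainv mem_vspace_of //= => [|a {}f g].
  by rewrite mem0v; apply/constrainedP => x _; rewrite ffunE mxE.
move=> /andP[fN /constrainedP fU] /andP[gN /constrainedP gU]; rewrite memvD ?memvZ //=.
by apply/constrainedP => x xU; rewrite !ffunE !mxE fU // gU // mulr0 addr0.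
Qed.

Lemma dim_limg_le (f : 'Hom(C, C)) S : (\dim (f @: S) <= \dim S)%N.
Proof. by rewrite -(limg_ker_dim f S) leq_addl. Qed.

Definition linev N x b U := vspace_of [pred f : C | (f \in crossv N (x |: U)) && (f x b 0 == 0)].
Lemma mem_linev N x b U f : (f \in linev N x b U) = (f \in crossv N (x |: U)) && (f x b 0 == 0).
Proof.
rewrite /linev mem_vspace_of //= => [|a {}f g]; first by rewrite mem0v ffunE mxE eqxx.
by move=> /andP[fN /eqP fU] /andP[gN /eqP gU]; rewrite memvD ?memvZ //= !ffunE !mxE fU gU mulr0
  addr0.
Qed.

Lemma dim_reducev_crossv N x b U : x \notin U ->
  (\dim (crossv (reducev N x b) U) <= \dim (linev N x b U))%N.
Proof.
move=> xU; apply: leq_trans (dim_limg_le (linfun (proj (~: [set x]))) _).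
apply: dimvS; apply/subvP => h; rewrite mem_crossv => /andP[/reducevP[hx [f [fN fx fy]]]
  /supportedP hU].
apply/memv_imgP; exists f.
  rewrite mem_linev mem_crossv fN fx eqxx andbT; apply/supportedP => y.
  by rewrite !inE negb_or => /andP[yx yU]; rewrite -fy // hU.
rewrite lfunE; apply/ffunP => y; rewrite ffunE !inE.
by have [->|yx] := eqVneq y x; [apply: hU | apply: fy].
Qed.

(** A chain in both spaces has both entries zero at [x], so its support is in [U :&: W]. This
    inequality sets deletion of [x] against its contraction. *)
Lemma dim_linev N x U W : x \notin U -> x \notin W ->
  (\dim (linev N x 0%R U) + \dim (linev N x 1%R W) <=
   \dim (crossv N (U :&: W)) + \dim (crossv N (x |: (U :|: W))))%N.
Proof.
move=> xU xW; rewrite -dimv_sum_cap addnC leq_add // dimvS //.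
  apply/subvP => f; rewrite memv_cap !mem_linev !mem_crossv.
  move=> /andP[/andP[/andP[fN /supportedP fU] /eqP f0] /andP[/andP[_ /supportedP fW] /eqP f1]].
  rewrite fN; apply/supportedP => y; have [-> _|yx] := eqVneq y x.
    by apply/matrixP => i j; rewrite ord1 mxE; have [->|->] := ord2E i.
  by rewrite inE negb_and => /orP[yU|yW]; [apply: fU | apply: fW]; rewrite !inE negb_or yx.
rewrite subv_add; apply/andP; split; apply/subvP => f; rewrite mem_linev => /andP[fN _];
  apply: subvP fN; apply: crossvS; apply: setUS; [exact: subsetUl | exact: subsetUr].
Qed.

(* Removing A :\: B as prescribed by [b] turns [N] into a chain-group [M] on
   B :|: ~: A; these are the dimensions of M x B, M x ~: A and M . B. *)
Definition inner_dim N b A B := \dim (linfun (proj B) @: crossv (constrainv N b (A :\: B)) A)%VS.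
Definition outer_dim N b A B := \dim (linfun (proj (~: A)) @: crossv (constrainv N b (A :\: B))
  (~: B))%VS.
Definition trace_dim N b A B := \dim (linfun (proj B) @: constrainv N b (A :\: B))%VS.

(* Tutte's linking theorem: the elements of A \ B can be deleted or contracted
   one at a time without lowering the connectivity between B and ~: A. *)
Lemma linking N A B r : lagrangian N -> B \subset A ->
  (forall Z, B \subset Z -> Z \subset A -> \dim (crossv N Z) + r <= #|Z|)%N ->
  exists b : V -> 'I_2, [/\ inner_dim N b A B + r <= #|B|,
     outer_dim N b A B + r <= #|~: A| & #|B| + r <= trace_dim N b A B]%N.
Proof.
have [n] := ubnP #|A|; elim: n A N => // n IH A N An lagN BA HZ.
have [AB|/subsetPn[x xA xB]] := boolP (A \subset B).
  have {AB} AB : A = B by apply/eqP; rewrite eqEsubset AB BA.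
  subst A; exists (fun _ => 0).
  rewrite /inner_dim /outer_dim /trace_dim.
  have -> : constrainv N (fun _ => 0) (B :\: B) = N.
    apply/vspaceP => f; rewrite mem_constrainv; case: (f \in N) => //=.
    by apply/constrainedP => x; rewrite setDv inE.
  have HB := HZ B (subxx _) BA.
  have e1 := dim_lagrangian_crossvC B lagN.
  have e2 := dim_proj N B; have e3 := cardsC B.
  have h1 := dim_limg_le (linfun (proj B)) (crossv N B).
  have h2 := dim_limg_le (linfun (proj (~: B))) (crossv N (~: B)).
  have e4 : \dim N = #|V| by case: lagN.
  rewrite e4 in e2; clear HZ IH lagN e4.
  split; lia.
(* If the two reductions failed, on [X] and on [Y], the failures would exceed the bounds by 2 in
   total, while in [dim_linev] the element [x] accounts for only 1. *)
have [b0 Hb0] : exists b0, forall Z, B \subset Z -> Z \subset A :\ x ->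
    (\dim (crossv (reducev N x b0) Z) + r <= #|Z|)%N.
  have [/forallP H0|/forallPn[X]] := boolP [forall Z : {set V}, (B \subset Z) && (Z \subset A
    :\ x)
      ==> (\dim (crossv (reducev N x 0%R) Z) + r <= #|Z|)%N].
    by exists 0 => Z BZ ZA; move: (H0 Z); rewrite BZ ZA.
  rewrite negb_imply -ltnNge => /andP[/andP[BX XA] hX].
  exists 1 => Y BY YA; rewrite leqNgt; apply/negP => hY.
  move: XA YA; rewrite !subsetD1 => /andP[XA xX] /andP[YA xY].
  have h1 := dim_reducev_crossv N 0 xX; have h2 := dim_reducev_crossv N 1 xY.
  have h3 := dim_linev N xX xY.
  have h4 : (\dim (crossv N (X :&: Y)) + r <= #|X :&: Y|)%N.
    by apply: HZ; rewrite ?subsetI ?BX // subIset // XA.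
  have h5 : (\dim (crossv N (x |: (X :|: Y))) + r <= #|x |: (X :|: Y)|)%N.
    apply: HZ; last by rewrite !subUset sub1set xA XA.
    by rewrite (subset_trans BX) // setUCA subsetUl.
  have h6 : #|x |: (X :|: Y)| = #|X :|: Y|.+1 by rewrite cardsU1 !inE negb_or xX xY.
  have h7 := cardsUI X Y; rewrite h6 in h5; clear HZ IH An lagN.
  lia.
pose N' := reducev N x b0.
have BA' : B \subset A :\ x by rewrite subsetD1 BA.
have cA := cardsD1 x A; rewrite xA add1n in cA.
have [b' [H1 H2 H3]] := IH (A :\ x) N' (ltac:(by rewrite cA in An)) (lagrangian_reducev x b0
  lagN) BA' Hb0.
pose b y := if y == x then b0 else b' y.
have xD : x \in A :\: B by rewrite inE xB.
have DE y : (y \in (A :\ x) :\: B) = (y != x) && (y \in A :\: B).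
  by rewrite !inE; case: (y == x); rewrite ?andbF.
pose px f := proj (~: [set x]) f.
have pxE f y : px f y = if y == x then 0 else f y by rewrite ffunE !inE; case: eqP.
have pxN f : f \in constrainv N b (A :\: B) -> px f \in constrainv N' b' ((A :\ x) :\: B).
  rewrite !mem_constrainv => /andP[fN /constrainedP fb]; apply/andP; split.
    apply/reducevP; split; first by rewrite pxE eqxx mxE.
    exists f; split=> //; first by have := fb x xD; rewrite /b eqxx.
    by move=> y yx; rewrite pxE (negPf yx).
  apply/constrainedP => y; rewrite DE => /andP[yx yD]; rewrite pxE (negPf yx).
  by have := fb y yD; rewrite /b (negPf yx).
exists b; split.
- apply: leq_trans H1; rewrite leq_add2r dimvS //; apply/subvP => u /memv_imgP[f].
  rewrite mem_crossv => /andP[fN /supportedP fA] ->; apply/memv_imgP; exists (px f).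
    rewrite mem_crossv pxN //=; apply/supportedP => y; rewrite !inE negb_and negbK pxE.
    by case: eqP => //= _; apply: fA.
  rewrite !lfunE; apply/ffunP => y; rewrite /= !ffunE !inE; case: ifP => // yB.
  by case: eqP => // yx; rewrite -yx yB in xB.
(* Since [x] stays in the ground set of [N'], the outer side has one element too many; the chain
   [delta x b0], which vanishes outside [x], supplies the matching dimension. *)
- have cA' : #|~: (A :\ x)| = #|~: A|.+1.
    by have := cardsC A; have := cardsC (A :\ x); rewrite cA; lia.
  rewrite cA' in H2; rewrite -ltnS -addSn; apply: leq_trans H2; rewrite leq_add2r.
  (* [b0 + 1] is the other index of ['I_2], the entry where [delta x b0] equals 1. *)
  have d1 : \dim <[delta x b0]>%VS = 1%N.
    rewrite dim_vline; case: eqP => // /ffunP/(_ x)/matrixP/(_ (b0 + 1) 0).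
    rewrite !ffunE eqxx !mxE => /eqP; rewrite -subr_eq0 subr0.
    by have [->|->] := ord2E b0; rewrite oner_eq0.
  rewrite /outer_dim -addn1 -[X in (_ + X <= _)%N]d1 -dimv_disjoint_sum; last first.
    apply/eqP; rewrite -subv0; apply/subvP => u; rewrite memv_cap => /andP[/memv_imgP[f _ ->]].
    rewrite lfunE memv0 => /vlineP[a E]; have := congr1 (fun h : C => h x (b0 + 1) 0) E.
    rewrite /= !ffunE !inE xA /= eqxx !mxE.
    have -> : (b0 + 1 != b0) by have [->|->] := ord2E b0.
    by rewrite mulr1 E => <-; rewrite scale0r.
  rewrite dimvS // subv_add; apply/andP; split.
    apply/subvP => u /memv_imgP[f].
    rewrite mem_crossv => /andP[fN /supportedP fB] ->; apply/memv_imgP; exists (px f).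
      rewrite mem_crossv pxN //=; apply/supportedP => y yB; rewrite pxE.
      by case: eqP => //= _; apply: fB.
    rewrite !lfunE; apply/ffunP => y; rewrite /= !ffunE !inE.
    by case: eqP => //= ->; rewrite xA.
  rewrite -memvE; apply/memv_imgP; exists (delta x b0); last first.
    rewrite lfunE; apply/ffunP => y; rewrite /= !ffunE !inE.
    by case: eqP => //= _; case: ifP.
  rewrite mem_crossv mem_constrainv delta_reducev /=; apply/andP; split.
    by apply/constrainedP => y; rewrite DE => /andP[yx _]; rewrite ffunE (negPf yx) mxE.
  apply/supportedP => y; rewrite inE negbK ffunE => yB.
  by case: eqP => // yx; rewrite -yx yB in xB.
apply: leq_trans H3 _; rewrite dimvS //; apply/subvP => u /memv_imgP[h].
rewrite mem_constrainv => /andP[/reducevP[hx [f [fN fx fy]]] /constrainedP hb] ->.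
apply/memv_imgP; exists f.
  rewrite mem_constrainv fN /=; apply/constrainedP => y yD; rewrite /b.
  have [->//|yx] := eqVneq y x; rewrite -fy //; apply: hb.
  by rewrite DE yx.
rewrite !lfunE; apply/ffunP => y; rewrite /= !ffunE; case: ifP => // yB.
by apply: fy; apply: contraTneq yB => ->.
Qed.

(** * Colors of chains, and linked sets *)

Lemma mem_crossvD N U f : f \in N ->
  (f \in crossv N U + crossv N (~: U))%VS = (proj U f \in N).
Proof.
move=> fN; apply/memv_addP/idP => [[u hu [v hv E]]|h].
  suff -> : proj U f = u by move: hu; rewrite mem_crossv => /andP[].
  move: hu hv; rewrite !mem_crossv => /andP[_ /supportedP uU] /andP[_ /supportedP vU].
  apply/ffunP => x; rewrite E !ffunE; case: ifPn => [xU|/uU //].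
  by rewrite vU ?addr0 // inE xU.
exists (proj U f); first by rewrite mem_crossv h supported_proj.
exists (f - proj U f); last by rewrite addrC subrK.
rewrite mem_crossv memvB //=; apply/supportedP => x; rewrite inE negbK => xU.
by rewrite !ffunE xU subrr.
Qed.

Lemma projC U f : proj (~: U) f = f - proj U f.
Proof. by apply/ffunP => x; rewrite !ffunE inE; case: (x \in U); rewrite /= ?subrr ?subr0. Qed.

(** The quotient of [N] by the sum has dimension [2 * conn N U], hence the [2 * K] coordinates;
    those in excess are set to 0. *)
Lemma coloring N U K : lagrangian N -> (conn N U <= K)%N ->
  exists col : C -> {ffun 'I_(2 * K) -> F}, forall f g, f \in N -> g \in N ->
    col f = col g <-> (f - g \in crossv N U + crossv N (~: U))%VS.
Proof.
move=> lagN UK; pose W := (crossv N U + crossv N (~: U))%VS.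
pose q : 'End(C) := (\1 - projv W)%VF; pose Y := (q @: N)%VS.
have qE f : q f = f - projv W f by rewrite add_lfunE opp_lfunE id_lfunE.
have q0 f : (q f == 0) = (f \in W).
  rewrite qE subr_eq0; apply/eqP/idP => [->|/projv_id->//]; exact: memv_proj.
have dimY : (\dim Y <= 2 * K)%N.
  have WN : (W <= N :&: lker q)%VS.
    rewrite subv_cap subv_add !crossv_sub /=.
    by apply/subvP => f fW; rewrite memv_ker q0.
  have h1 := dimvS WN; rewrite dimv_disjoint_sum in h1; last first.
    rewrite -crossvI setICr; apply/eqP; rewrite -subv0; apply/subvP => f.
    rewrite mem_crossv memv0 => /andP[_ /supportedP h]; apply/eqP/ffunP => x.
    by rewrite h ?inE // ffunE.
  have h2 : (_ = #|V|)%N := etrans (limg_ker_dim q N) lagN.2.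
  have h3 := dim_lagrangian_crossvC U lagN; have h4 := connE lagN U.
  have arith dU dC dk dY n c u : (dU + dC <= dk -> dk + dY = n -> dC + 2 * u = n + dU ->
    c + dU = u -> c <= K -> dY <= 2 * K)%N by lia.
  exact: arith h1 h2 h3 h4 UK.
pose col (f : C) : {ffun 'I_(2 * K) -> F} := [ffun k =>
  if insub (val k) is Some i then coord (vbasis Y) (i : 'I_(\dim Y)) (q f) else 0].
have qY f : f \in N -> q f \in Y by move=> fN; rewrite memv_img.
have qB f g : q (f - g) = q f - q g by apply: linearB.
exists col => f g fN gN; rewrite -/W -q0 qB subr_eq0; split=> [E|/eqP E].
  apply/eqP; rewrite (coord_vbasis (qY _ fN)) [RHS](coord_vbasis (qY _ gN)).
  apply: eq_bigr => i _; congr (_ *: _).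
  have := congr1 (fun c : {ffun 'I_(2 * K) -> F} => c (widen_ord dimY i)) E; rewrite !ffunE.
  by rewrite /= valK.
by apply/ffunP => k; rewrite !ffunE E.
Qed.

(** With [r := conn N B], the inequalities of [linking] are tight and turn inclusions of spaces into
    equalities. The one for traces gives the extension property; those for the inner and the outer
    space give the two directions of the equivalence, by which being congruent relative to [A] or to
    [B] is the same on the constrained chains. *)
Lemma linked_constraint N A B : lagrangian N -> B \subset A -> conn N A = conn N B ->
  (forall Z, B \subset Z -> Z \subset A -> conn N B <= conn N Z)%N ->
  exists b : V -> 'I_2,
    (forall f, f \in N -> exists2 g, g \in constrainv N b (A :\: B) & forall x, x \in B -> g x
      = f x) /\
    (forall f, f \in constrainv N b (A :\: B) -> (proj A f \in N) = (proj B f \in N)).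
Proof.
move=> lagN BA cAB HZ.
have [|b [H1 H2 H3]] := linking lagN BA (r := conn N B).
  by move=> Z BZ ZA; have := HZ Z BZ ZA; rewrite -(connE lagN Z) addnC leq_add2r.
have DA x : x \in A :\: B -> x \in A by rewrite inE => /andP[].
have DB x : x \in A :\: B -> x \in ~: B by rewrite !inE => /andP[].
have inner : (linfun (proj B) @: crossv (constrainv N b (A :\: B)) A)%VS = crossv N B.
  apply/esym/eqP; rewrite eqEdim; apply/andP; split.
    apply/subvP => f; rewrite mem_crossv => /andP[fN fB].
    apply/memv_imgP; exists f; last by rewrite lfunE /= proj_supported.
    rewrite mem_crossv mem_constrainv fN /=; apply/andP; split.
      apply/constrainedP => x; rewrite inE => /andP[xB _].
      by move/supportedP: fB => ->; rewrite ?mxE.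
    by apply/supportedP => x xA; move/supportedP: fB; apply; apply: contra xA; apply: (subsetP
      BA).
  by move: H1; rewrite /inner_dim -{1}(connE lagN B) addnC leq_add2l.
have outer : (linfun (proj (~: A)) @: crossv (constrainv N b (A :\: B)) (~: B))%VS = crossv N
  (~: A).
  apply/esym/eqP; rewrite eqEdim; apply/andP; split.
    apply/subvP => f; rewrite mem_crossv => /andP[fN fA].
    apply/memv_imgP; exists f; last by rewrite lfunE /= proj_supported.
    rewrite mem_crossv mem_constrainv fN /=; apply/andP; split.
      apply/constrainedP => x /DA xA.
      by move/supportedP: fA => ->; rewrite ?mxE // inE xA.
    apply/supportedP => x; rewrite inE negbK => xB; move/supportedP: fA; apply.
    by rewrite inE negbK (subsetP BA).
  by move: H2; rewrite /outer_dim -{1}(connE lagN (~: A)) (connC lagN) cAB addnC leq_add2l.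
exists b; split=> [f fN|f fb].
  have tr : (linfun (proj B) @: constrainv N b (A :\: B) = linfun (proj B) @: N)%VS.
    apply/eqP; rewrite eqEdim limgS /=; last first.
      by apply/subvP => g; rewrite mem_constrainv => /andP[].
    apply: leq_trans H3.
    have := dim_proj N B; have := dim_lagrangian_crossvC B lagN; have := connE lagN B.
    by have : \dim N = #|V| by [case: lagN]; clear; lia.
  have : linfun (proj B) f \in (linfun (proj B) @: constrainv N b (A :\: B))%VS.
    by rewrite tr memv_img.
  case/memv_imgP => g gb; rewrite !lfunE => /ffunP E; exists g => // x xB.
  by have := E x; rewrite /= !ffunE xB.
move: (fb); rewrite mem_constrainv => /andP[fN /constrainedP fc].
apply/idP/idP => h.
  suff : proj B f \in crossv N B by rewrite mem_crossv => /andP[].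
  rewrite -inner; apply/memv_imgP; exists (proj A f).
    rewrite mem_crossv supported_proj mem_constrainv h andbT /=.
    by apply/constrainedP => x xD; rewrite ffunE (DA _ xD) fc.
  rewrite lfunE; apply/ffunP => x; rewrite !ffunE; case: ifP => // xB.
  by rewrite (subsetP BA).
suff : proj (~: A) f \in crossv N (~: A).
  by rewrite mem_crossv projC => /andP[h' _]; rewrite -[proj A f]opprK -[- proj A f](addKr f)
    opprD opprK memvB.
rewrite -outer; apply/memv_imgP; exists (proj (~: B) f).
  rewrite mem_crossv supported_proj mem_constrainv projC memvB //= andbT.
  by apply/constrainedP => x xD; rewrite -projC ffunE (DB _ xD) fc.
rewrite lfunE; apply/ffunP => x; rewrite !ffunE; case: ifP => // xA.
by rewrite ifT // inE; move: xA; rewrite inE; apply: contra; apply: (subsetP BA).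
Qed.
End Form.
End ChainSpaces.

Section Connectivity.
Variables (F : finFieldType) (N : chain_group F).

Lemma dim_cross (T : {set cg_ground N}) : \dim (cross T) = \dim (crossv (cg_space N) T).
Proof.
have -> : cross T = (linfun (@restr F _ T) @: crossv (cg_space N) T)%VS.
  apply/vspaceP => g; apply/idP/idP.
    move=> /mem_cross[f [fN fT ->]]; rewrite -(lfunE (@restr F _ T)) memv_img // mem_crossv fN.
    exact/supportedP.
  move=> /memv_imgP[f]; rewrite mem_crossv => /andP[fN /supportedP fT] ->; apply/mem_cross.
  by exists f; rewrite lfunE.
apply: limg_dim_eq; apply/eqP; rewrite -subv0; apply/subvP => f.
rewrite memv_cap mem_crossv memv_ker lfunE memv0 => /andP[/andP[_ /supportedP fT] /eqP/ffunP h].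
apply/eqP/ffunP => x; rewrite ffunE; have [xT|/fT //] := boolP (x \in T).
by have := h (Sub x xT); rewrite !ffunE /=.
Qed.

Lemma connectivityE (U : {set cg_ground N}) : Lagrangian N ->
  connectivity U = (conn (cg_space N) U)%:R.
Proof.
move=> lagN; rewrite /connectivity !dim_cross.
have lag : lagrangian (cg_form N) (cg_space N) := lagN.
have arith (n a b c u : nat) : (b + 2 * u = n + a)%N -> (c + a = u)%N ->
    (n%:R - b%:R - a%:R) / 2 = c%:R :> rat.
  move=> h1 h2; have -> : n = (2 * c + a + b)%N by lia.
  by rewrite (natrD _ _ b) addrK natrD addrK natrM mulrC mulKf.
apply: arith (connE lag U); rewrite lagN.2.
exact: dim_lagrangian_crossvC U lag.
Qed.
End Connectivity.

(** * Colored pieces *)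

(** The images of [u] and [v] are matched through [P], the remaining colors by listing the two
    complements in order. *)
Lemma extend_perm (X C : finType) (P : {set X}) (u v : X -> C) :
  (forall f g, f \in P -> g \in P -> u f = u g <-> v f = v g) ->
  exists p : {perm C}, forall f, f \in P -> p (u f) = v f.
Proof.
move=> uv; have [->|[f0 f0P]] := set_0Vmem P; first by exists 1%g => f; rewrite inE.
pose rep c := odflt f0 [pick f in P | u f == c].
have repP f : f \in P -> rep (u f) \in P /\ v (rep (u f)) = v f.
  move=> fP; rewrite /rep; case: pickP => [g /andP[gP /eqP ug]|/(_ f)] /=.
    by split=> //; apply/(uv g f).
  by rewrite fP eqxx.
pose S1 := u @: P; pose S2 := v @: P; pose c0 := v f0.
pose L1 := enum S1 ++ enum (~: S1).
pose L2 := [seq v (rep c) | c <- enum S1] ++ enum (~: S2).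
have rS c : c \in S1 -> exists2 f, f \in P & c = u f by case/imsetP => f; exists f.
have L1c c : c \in L1 by rewrite mem_cat !mem_enum inE orbN.
have u1 : uniq L1.
  rewrite cat_uniq !enum_uniq andbT /=; apply/hasPn => c; rewrite !mem_enum inE //.
have u2 : uniq L2.
  rewrite cat_uniq enum_uniq andbT; apply/andP; split.
    rewrite map_inj_in_uniq ?enum_uniq // => c d; rewrite !mem_enum.
    move=> /rS[f fP ->] /rS[g gP ->]; rewrite (repP f fP).2 (repP g gP).2.
    by move=> h; apply/(uv f g).
  apply/hasPn => c; rewrite mem_enum inE; apply: contra => /mapP[d].
  rewrite mem_enum => /rS[f fP ->] ->; rewrite (repP f fP).2; exact: imset_f.
have sz : (size L1 <= size L2)%N.
  rewrite !size_cat size_map leq_add2l -!cardE -(leq_add2l #|S1|) cardsC -(cardsC S2) leq_add2r.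
  apply: leq_trans (leq_imset_card (v \o rep) S1); apply: subset_leq_card.
  apply/subsetP => c /imsetP[f fP ->]; apply/imsetP; exists (u f); first exact: imset_f.
  by rewrite /= (repP f fP).2.
pose pi c := nth c0 L2 (index c L1).
have ix c : (index c L1 < size L2)%N by apply: leq_trans sz; rewrite index_mem.
have pi_inj : injective pi.
  move=> c d /eqP; rewrite /pi nth_uniq // => /eqP h.
  by rewrite -[c](nth_index c0 (L1c c)) -[d](nth_index c0 (L1c d)) h.
exists (perm pi_inj) => f fP; rewrite permE /pi /L1 index_cat mem_enum imset_f //.
have ufS : u f \in enum S1 by rewrite mem_enum imset_f.
rewrite nth_cat size_map index_mem ufS (nth_map c0) ?index_mem // nth_index //.
exact: (repP f fP).2.
Qed.

(* Along an increasing chain the partial products of the witnesses take some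
   value twice, and between these two places the witness is trivial. *)
Lemma wqo_group_trivial (G : finGroupType) (E : Type) (r : G -> E -> E -> Prop) (P : E -> Prop) :
  (forall g h x y z, r g x y -> r h y z -> r (g * h)%g x z) ->
  wqo_on (fun x y => exists g, r g x y) P -> wqo_on (r 1%g) P.
Proof.
move=> tr w s Ps.
have [|phi hphi ch] := wqo_chain _ w Ps.
  by move=> x y z [g hg] [h hh]; exists (g * h)%g; apply: tr hg hh.
have [c hc] := fun_choice (fun i => ch i i.+1 (ltnSn i)).
pose p := fix p n := if n is m.+1 then (p m * c m)%g else 1%g.
have key i d : r ((p i)^-1 * p (i + d.+1)%N)%g (s (phi i)) (s (phi (i + d.+1)%N)).
  elim: d => [|d IH]; first by rewrite addn1 /= mulKg; apply: hc.
  by rewrite addnS /= mulgA; apply: tr IH (hc _).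
have [i [j [ij E1]]] := @wqo_finType G p (fun _ => Logic.I).
exists (phi i), (phi j); split; first exact: hphi.
have := key i (j - i).-1; rewrite prednK ?subn_gt0 // subnKC ?(ltnW ij) // E1 mulVg //.
Qed.

Section Pieces.
Variables (Q : Type) (le : Q -> Q -> Prop) (F : finFieldType) (K : nat).
Hypothesis le_refl : forall x, le x x.
Hypothesis le_trans : forall x y z, le x y -> le y z -> le x z.
Local Notation Col := {ffun 'I_(2 * K) -> F}.

(** The whole chain-group is kept together with the node, so that all nodes of a tree share one
    ground set; only traces on [pc_set] are observed, through [realizes]. *)
Record piece := Piece {
  pc_ground : finType;
  pc_space : {vspace chain F pc_ground};
  pc_label : pc_ground -> Q;
  pc_set : {set pc_ground};
  pc_col : chain F pc_ground -> Col
}.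
Implicit Types p : piece.

Definition realizes p (h : chain F (pc_ground p)) (c : Col) :=
  exists f, [/\ f \in pc_space p, pc_col f = c & forall x, x \in pc_set p -> f x = h x].

(* The elements of [pc_set p] outside the image of [mu] are removed: [b y = 0]
   means that [y] is contracted, [b y = 1] that it is deleted. *)
Definition piece_le (pi : {perm Col}) p' p :=
  exists (mu : pc_ground p' -> pc_ground p) (b : pc_ground p -> 'I_2),
  [/\ {in pc_set p' &, injective mu},
      forall x, x \in pc_set p' -> mu x \in pc_set p /\ le (pc_label x) (pc_label (mu x)) &
      forall h c, realizes h c <-> exists f, [/\ f \in pc_space p, pc_col f = pi c,
        forall x, x \in pc_set p' -> f (mu x) = h x &
        forall y, y \in pc_set p -> y \notin mu @: pc_set p' -> f y (b y) 0 = 0]].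

Lemma piece_le_trans pi rho p1 p2 p3 :
  piece_le pi p1 p2 -> piece_le rho p2 p3 -> piece_le (pi * rho)%g p1 p3.
Proof.
move=> [mu [b [inj1 lab1 H1]]] [nu [d [inj2 lab2 H2]]].
(* An element coming from [p2] is treated as in the first comparison, any other as in the second. *)
pose e y := if [pick x in pc_set p2 | nu x == y] is Some x then b x else d y.
have eE x : x \in pc_set p2 -> e (nu x) = b x.
  move=> x2; rewrite /e; case: pickP => [z /andP[z2 /eqP E]|/(_ x)].
    by rewrite (inj2 z x).
  by rewrite x2 eqxx.
have eN y : y \notin nu @: pc_set p2 -> e y = d y.
  move=> yn; rewrite /e; case: pickP => // z /andP[z2 /eqP E].
  by rewrite -E imset_f in yn.
have notin x : x \in pc_set p2 -> (nu x \in (nu \o mu) @: pc_set p1) = (x \in mu @: pc_set p1).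
  move=> x2; apply/imsetP/imsetP => [[z z1 E]|[z z1 ->]]; exists z => //.
  by apply: inj2 E => //; case: (lab1 z z1).
have sub y : y \in (nu \o mu) @: pc_set p1 -> y \in nu @: pc_set p2.
  by case/imsetP => z z1 ->; apply: imset_f; case: (lab1 z z1).
exists (nu \o mu), e; split.
- move=> x y x1 y1 /= /inj2 h; apply: inj1 => //; apply: h.
    by case: (lab1 x x1).
  by case: (lab1 y y1).
- move=> x x1; have [m2 l1] := lab1 x x1; have [n3 l2] := lab2 _ m2; split=> //.
  exact: le_trans l1 l2.
move=> h c; split.
  move/H1 => [f [fN fc fh fb]].
  have /H2[g [gN gc gf gd]] : realizes f (pi c) by exists f; split.
  exists g; split=> //; first by rewrite permM.
    by move=> x x1; rewrite /= gf ?fh //; case: (lab1 x x1).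
  move=> y y3 yn; have [/imsetP[x x2 E]|yn2] := boolP (y \in nu @: pc_set p2).
    by rewrite E in yn *; rewrite eE // gf // fb // -notin.
  by rewrite eN // gd.
move=> [g [gN gc gh ge]]; apply/H1.
have [f [fN fc fg]] : realizes [ffun x => g (nu x)] (pi c).
  apply/H2; exists g; split=> //; first by rewrite gc permM.
    by move=> x x2; rewrite ffunE.
  move=> y y3 yn; rewrite -eN // ge //; by apply: contra yn; apply: sub.
exists f; split=> //.
  by move=> x x1; rewrite fg ?ffunE ?gh //; case: (lab1 x x1).
move=> y y2 yn; rewrite fg // ffunE -eE // ge //; first by case: (lab2 y y2).
by rewrite notin.
Qed.

Definition proper_coloring (V : finType) (N : {vspace chain F V}) (A : {set V})
    (col : chain F V -> Col) :=
  forall f g, f \in N -> g \in N -> col f = col g <-> proj A (f - g) \in N.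

Section Glue.
Variables (V : finType) (N : {vspace chain F V}) (lab : V -> Q) (A1 A2 : {set V})
  (col1 col2 col : chain F V -> Col).
Hypothesis dA : [disjoint A1 & A2].
Hypothesis ok1 : proper_coloring N A1 col1.
Hypothesis ok2 : proper_coloring N A2 col2.
Hypothesis ok : proper_coloring N (A1 :|: A2) col.

(* This finite datum determines the realized pairs of [A1 :|: A2] from those of
   [A1] and [A2]. *)
Definition gluing : {set Col * Col * Col} :=
  [set t | [exists f, [&& f \in N, col1 f == t.1.1, col2 f == t.1.2 & col f == t.2]]].

Lemma realizes_glue h c :
  realizes (p := Piece N lab (A1 :|: A2) col) h c <->
  exists c1 c2, [/\ realizes (p := Piece N lab A1 col1) h c1,
    realizes (p := Piece N lab A2 col2) h c2 & (c1, c2, c) \in gluing].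
Proof.
split=> [[f [/= fN fc fh]]|[c1 [c2 [[f1 [/= f1N f1c f1h]] [f2 [/= f2N f2c f2h]]]]]].
  exists (col1 f), (col2 f); split.
  - by exists f; split=> // x x1; apply: fh; rewrite inE x1.
  - by exists f; split=> // x x2; apply: fh; rewrite inE x2 orbT.
  by rewrite inE; apply/existsP; exists f; rewrite fN fc !eqxx.
rewrite inE => /existsP[f /= /and4P[fN /eqP e1 /eqP e2 /eqP e]].
have h1 : proj A1 (f1 - f) \in N by apply/(ok1 f1N fN); rewrite f1c e1.
have h2 : proj A2 (f2 - f) \in N by apply/(ok2 f2N fN); rewrite f2c e2.
set u := proj A1 _ in h1; set v := proj A2 _ in h2.
(* [f] witnesses the triple of colors and is corrected to [f1] on [A1] and to [f2] on [A2]. The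
   correction lies in [N] and is supported in the union, so the color of [f] there is unchanged. *)
exists (f + (u + v)); split=> /=.
- by rewrite memvD ?memvD.
- rewrite -e; apply/ok => //; first by rewrite memvD ?memvD.
  rewrite addrC addKr proj_supported ?memvD //.
  apply/supportedP => x; rewrite inE negb_or => /andP[/negPf x1 /negPf x2].
  by rewrite !ffunE x1 x2 addr0.
move=> x; rewrite inE !ffunE; have [x1 _|nx1 /= x2] := boolP (x \in A1).
  by rewrite (disjointFr dA x1) addr0 addrC subrK f1h.
by rewrite x2 add0r addrC subrK f2h.
Qed.
End Glue.

Section GlueLe.
Variables (V V' : finType) (N : {vspace chain F V}) (N' : {vspace chain F V'})
  (lab : V -> Q) (lab' : V' -> Q) (A1 A2 : {set V}) (A1' A2' : {set V'})
  (col1 col2 col : chain F V -> Col) (col1' col2' col' : chain F V' -> Col).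
Hypotheses (dA : [disjoint A1 & A2]) (dA' : [disjoint A1' & A2']).
Hypothesis ok1 : proper_coloring N A1 col1.
Hypothesis ok2 : proper_coloring N A2 col2.
Hypothesis ok : proper_coloring N (A1 :|: A2) col.
Hypothesis ok1' : proper_coloring N' A1' col1'.
Hypothesis ok2' : proper_coloring N' A2' col2'.
Hypothesis ok' : proper_coloring N' (A1' :|: A2') col'.

Lemma piece_le_glue : gluing N' col1' col2' col' = gluing N col1 col2 col ->
  piece_le 1%g (Piece N' lab' A1' col1') (Piece N lab A1 col1) ->
  piece_le 1%g (Piece N' lab' A2' col2') (Piece N lab A2 col2) ->
  piece_le 1%g (Piece N' lab' (A1' :|: A2') col') (Piece N lab (A1 :|: A2) col).
Proof.
move=> eqS [m1 [b1 [/= i1 l1 H1]]] [m2 [b2 [/= i2 l2 H2]]].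
pose mu x := if x \in A1' then m1 x else m2 x.
pose b y := if y \in A1 then b1 y else b2 y.
have mu1 x : x \in A1' -> mu x = m1 x by rewrite /mu => ->.
have mu2 x : x \in A2' -> mu x = m2 x by move=> x2; rewrite /mu (disjointFl dA' x2).
have m1A x : x \in A1' -> m1 x \in A1 by move/l1 => [].
have m2A x : x \in A2' -> m2 x \in A2 by move/l2 => [].
have im1 y : y \in A1 -> (y \in mu @: (A1' :|: A2')) = (y \in m1 @: A1').
  move=> y1; apply/imsetP/imsetP => [[x]|[x x1 ->]]; last first.
    by exists x; rewrite ?inE ?x1 // mu1.
  rewrite inE => /orP[x1|x2] E; first by exists x => //; rewrite E mu1.
  by have := disjointFr dA y1; rewrite E mu2 // m2A.
have im2 y : y \in A2 -> (y \in mu @: (A1' :|: A2')) = (y \in m2 @: A2').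
  move=> y1; apply/imsetP/imsetP => [[x]|[x x1 ->]]; last first.
    by exists x; rewrite ?inE ?x1 ?orbT // mu2.
  rewrite inE => /orP[x2|x1] E; last by exists x => //; rewrite E mu2.
  by have := disjointFl dA y1; rewrite E mu1 // m1A.
have G' := realizes_glue (lab := lab') dA' ok1' ok2' ok'.
have G := realizes_glue (lab := lab) dA ok1 ok2 ok.
exists mu, b; split=> /=.
- move=> x y; rewrite !inE => /orP[x1|x2] /orP[y1|y2].
  + by rewrite !mu1 //; apply: i1.
  + rewrite mu1 // mu2 // => E; have := disjointFr dA (m1A _ x1).
    by rewrite E m2A.
  + rewrite mu2 // mu1 // => E; have := disjointFr dA (m1A _ y1).
    by rewrite -E m2A.
  by rewrite !mu2 //; apply: i2.
- move=> x; rewrite !inE => /orP[x1|x2].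
    by rewrite mu1 //; have [-> ?] := l1 x x1.
  by rewrite mu2 //; have [-> ?] := l2 x x2; rewrite orbT.
move=> h c; split.
  move=> /G'[c1 [c2 [/H1[f1 [f1N f1c f1h f1b]] /H2[f2 [f2N f2c f2h f2b]] S]]].
  rewrite eqS in S; rewrite perm1 in f1c; rewrite perm1 in f2c.
  pose h' : chain F V := [ffun y => if y \in A1 then f1 y else f2 y].
  have /G[f [/= fN fc fh]] : exists c1 c2, [/\ realizes (p := Piece N lab A1 col1) h' c1,
    realizes (p := Piece N lab A2 col2) h' c2 & (c1, c2, c) \in gluing N col1 col2 col].
    exists c1, c2; split=> //.
      by exists f1; split=> //= x x1; rewrite ffunE x1.
    by exists f2; split=> //= x x2; rewrite ffunE (disjointFl dA x2).
  exists f; split=> //; first by rewrite perm1.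
    move=> x; rewrite inE => /orP[x1|x2].
      by rewrite mu1 // fh ?inE ?m1A // ffunE m1A // f1h.
    by rewrite mu2 // fh ?inE ?m2A ?orbT // ffunE (disjointFl dA (m2A _ x2)) f2h.
  move=> y yA; rewrite fh // ffunE /b; move: yA; rewrite inE.
  case: (boolP (y \in A1)) => [y1 _|ny1 /= y2].
    by rewrite im1 // => yn; apply: f1b.
  by rewrite im2 // => yn; apply: f2b.
move=> [f [fN fc fh fb]]; apply/G'; exists (col1 f), (col2 f); split.
- apply/H1; exists f; split=> //; first by rewrite perm1.
    by move=> x x1; rewrite -fh ?inE ?x1 // mu1.
  by move=> y y1 yn; have := fb y; rewrite inE y1 im1 // /b y1; apply.
- apply/H2; exists f; split=> //; first by rewrite perm1.
    by move=> x x2; rewrite -fh ?inE ?x2 ?orbT // mu2.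
  by move=> y y2 yn; have := fb y; rewrite inE y2 orbT im2 // /b (disjointFl dA y2); apply.
rewrite eqS inE; apply/existsP; exists f; rewrite fN /= !eqxx fc perm1 eqxx //.
Qed.
End GlueLe.

(** This invariant takes finitely many values, and on a one-element node it determines what is
    realized. *)
Definition point_type p x : {set 'cV[F]_2 * Col} :=
  [set t | [exists f, [&& f \in pc_space p, f x == t.1 & pc_col f == t.2]]].

Lemma piece_le_point p' p x' x : pc_set p' = [set x'] -> pc_set p = [set x] ->
  point_type x' = point_type x -> le (pc_label x') (pc_label x) -> piece_le 1%g p' p.
Proof.
move=> E' E ET lx; exists (fun _ => x), (fun _ => 0); split.
- by move=> y z; rewrite E' !inE => /eqP -> /eqP ->.
- by move=> y; rewrite E' E !inE => /eqP ->.
move=> h c.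
have mem q (z : pc_ground q) k d : (k, d) \in point_type z <-> exists f, [/\ f \in pc_space q,
  f z = k & pc_col f = d].
  rewrite inE; split=> [/existsP[f /and3P[fN /eqP fz /eqP fd]]|[f [fN fz fd]]]; first by exists f.
  by apply/existsP; exists f; rewrite fN fz fd !eqxx.
split=> [[f [fN fc fh]]|[f [fN fc fh _]]].
  have /mem[g [gN gx gc]] : (h x', c) \in point_type x.
    by rewrite -ET; apply/mem; exists f; split=> //; apply: fh; rewrite E' inE.
  exists g; split=> //; first by rewrite perm1.
    by move=> y; rewrite E' inE => /eqP ->.
  move=> y; rewrite E inE => /eqP ->; case/negP.
  by apply/imsetP; exists x' => //; rewrite E' inE.
have /mem[g [gN gx gc]] : (h x', c) \in point_type x'.
  rewrite ET; apply/mem; exists f; split=> //; last by rewrite fc perm1.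
  by apply: fh; rewrite E' inE.
by exists g; split=> // y; rewrite E' inE => /eqP ->.
Qed.

Lemma piece_le_linked s (V : finType) (N : {vspace chain F V}) (lab : V -> Q) (A B : {set V})
    (colA colB : chain F V -> Col) :
  lagrangian s N -> proper_coloring N A colA -> proper_coloring N B colB ->
  B \subset A -> conn N A = conn N B ->
  (forall Z : {set V}, B \subset Z -> Z \subset A -> conn N B <= conn N Z)%N ->
  exists pi, piece_le pi (Piece N lab B colB) (Piece N lab A colA).
Proof.
move=> lagN okA okB BA cAB HZ.
have [b [H1 H2]] := linked_constraint lagN BA cAB HZ.
set Nb := constrainv N b (A :\: B) in H1 H2.
have NbN f : f \in Nb -> f \in N by rewrite mem_constrainv => /andP[].
(* On the constrained chains both colorings have the same classes, so one is a renaming of the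
   other. *)
have [f g fP gP|pi Hpi] := @extend_perm _ _ [set f | f \in Nb] colB colA.
  rewrite !inE in fP gP.
  have := okA f g (NbN _ fP) (NbN _ gP); have := okB f g (NbN _ fP) (NbN _ gP).
  by rewrite (H2 (f - g)) ?memvB // => -[h1 h2] [h3 h4]; split=> h; [apply/h4/h1 | apply/h2/h3].
exists pi, id, b; split=> //=.
  by move=> x xB; split; [exact: (subsetP BA) | exact: le_refl].
move=> h c; split=> [[f [/= fN fc fh]]|[f [fN fc fh fb]]].
  have [g gb gf] := H1 f fN; have gN := NbN _ gb.
  have E : colB g = colB f.
    apply/(okB _ _ gN fN); rewrite (_ : proj B _ = 0) ?mem0v //.
    by apply/ffunP => x; rewrite !ffunE; case: ifP => // xB; rewrite gf // subrr.
  exists g; split=> //; first by rewrite -fc -E Hpi // inE.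
    by move=> x xB; rewrite gf // fh.
  move=> y yA; rewrite imset_id => yB; move: gb; rewrite mem_constrainv => /andP[_ /constrainedP].
  by apply; rewrite inE yA yB.
exists f; split=> //=; have fNb : f \in Nb.
  rewrite mem_constrainv fN; apply/constrainedP => y; rewrite inE => /andP[yB yA].
  by apply: fb => //; rewrite imset_id.
by apply: (perm_inj (s := pi)); rewrite Hpi ?inE.
Qed.

Lemma exists_proper_coloring s (V : finType) (N : {vspace chain F V}) (A : {set V}) :
  lagrangian s N -> (conn N A <= K)%N -> exists col, proper_coloring N A col.
Proof.
move=> lagN cA; have [col H] := coloring lagN cA; exists col => f g fN gN.
by have := H f g fN gN; rewrite mem_crossvD ?memvB.
Qed.
End Pieces.

(** * Minors *)

Lemma formK_e01 (F : fieldType) s (u : 'cV[F]_2) : formK s u e01 = 0 <-> u 0 0 = 0.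
Proof. by rewrite /formK !mxE; case: s; rewrite /= mulr1 mulr0 ?addr0 ?subr0. Qed.

Lemma formK_e10 (F : fieldType) s (u : 'cV[F]_2) : formK s u e10 = 0 <-> u 1 0 = 0.
Proof.
rewrite /formK !mxE; case: s; rewrite /= mulr1 mulr0 ?add0r ?sub0r //.
by split=> [/eqP|->]; rewrite ?oppr0 // oppr_eq0 => /eqP.
Qed.

Lemma Q_minor_of_embedding (F : fieldType) (Q : Type) (le : Q -> Q -> Prop)
    (N N' : labeled_chain_group F Q) (mu : cg_ground N -> cg_ground N')
    (b : cg_ground N' -> 'I_2) :
  cg_form N = cg_form N' -> injective mu ->
  (forall x, le (lcg_label x) (lcg_label (mu x))) ->
  (forall h, h \in cg_space N <-> exists f, [/\ f \in cg_space N',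
     forall x, f (mu x) = h x & forall y, y \notin codom mu -> f y (b y) 0 = 0]) ->
  exists M, Q_minor le N' M /\ labeled_simply_isomorphic N M.
Proof.
move=> eqf inj lab H.
pose X := [set y | (y \notin codom mu) && (b y == 0)].
pose Y := [set y | (y \notin codom mu) && (b y != 0)].
have dXY : [disjoint X & Y].
  rewrite -setI_eq0; apply/eqP/setP => y; rewrite !inE.
  by case: (b y == 0); rewrite ?andbF.
have b0 y : y \in X -> b y = 0 by rewrite inE => /andP[_ /eqP].
have b1 y : y \in Y -> b y = 1 by rewrite inE => /andP[_]; have [->|->] := ord2E (b y).
pose M := minor X Y.
have valM (w : cg_ground M) : minor_val w \in codom mu.
  have h1 := valP (val w); have h2 := valP w; move: h1 h2; rewrite /= !inE -/(minor_val w).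
  by case: (_ \in codom _) => //=; case: (_ == 0).
have [inv invE] : exists inv : cg_ground M -> cg_ground N, forall w, mu (inv w) = minor_val w.
  apply: (@fun_choice _ _ (fun w x => mu x = minor_val w)) => w.
  by have /codomP[x ->] := valM w; exists x.
have muX x : mu x \in ~: X by rewrite !inE codom_f.
have muY x : (Sub (mu x) (muX x) : {y | y \in ~: X}) \in ~: [set v | val v \in Y].
  by rewrite !inE /= codom_f.
pose nu x : cg_ground M := Sub (Sub (mu x) (muX x)) (muY x).
have nuE x : minor_val (nu x) = mu x by [].
have val_inj2 (w w' : cg_ground M) : minor_val w = minor_val w' -> w = w'.
  by move=> h; apply: val_inj; apply: val_inj.
have nuK : cancel nu inv by move=> x; apply: inj; rewrite invE nuE.
have invK : cancel inv nu by move=> w; apply: val_inj2; rewrite nuE invE.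
exists (LabeledChainGroup (fun w : cg_ground M => lcg_label (inv w))); split.
  by apply: QMinor => // w; rewrite -invE.
exists nu; last by move=> x /=; rewrite nuK.
split=> //; first by exists inv.
move=> g; split.
  move/H => [f [fN fmu fb]].
  pose f1 := restr (~: X) f.
  exists (restr (~: [set v : {y | y \in ~: X} | val v \in Y]) f1); last first.
    by apply/ffunP => x; rewrite !ffunE /= fmu.
  apply/mem_reduce; exists f1; split=> //.
    apply/mem_reduce; exists f; split=> // x xX; apply/formK_e01.
    by rewrite -(b0 x xX); apply: fb; move: xX; rewrite inE => /andP[].
  move=> v; rewrite inE => vY; apply/formK_e10; rewrite ffunE -(b1 _ vY); apply: fb.
  by move: vY; rewrite inE => /andP[].
move=> [f2 /mem_reduce[f1 [/mem_reduce[f [fN fX ->]] f1Y ->]] ->]; apply/H; exists f; split=> //.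
  by move=> x; rewrite !ffunE /=.
move=> y yn; have [b_0|b_1] := eqVneq (b y) 0.
  by rewrite b_0; apply/formK_e01/fX; rewrite inE yn b_0 eqxx.
have yY : y \in Y by rewrite inE yn b_1.
have yX : y \in ~: X by rewrite !inE yn (negPf b_1).
rewrite (b1 y yY); apply/(formK_e10 (cg_form N')).
by have := f1Y (Sub y yX); rewrite inE /= yY ffunE /= => ->.
Qed.

(** * Well-quasi-ordering the nodes of all the trees *)

Section Assembly.
Variables (Q : Type) (le : Q -> Q -> Prop) (F : finFieldType) (K : nat).
Hypothesis wqoQ : well_quasi_order le.
Variable N : nat -> labeled_chain_group F Q.
Hypothesis lagN : forall i, Lagrangian (N i).
Local Notation G i := (cg_ground (N i)).
Local Notation S i := (cg_space (N i)).
Local Notation Col := {ffun 'I_(2 * K) -> F}.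
Variable T : forall i, {set {set G i}}.
Hypothesis treeT : forall i, tree_family (T i).
Hypothesis connK : forall i (A : {set G i}), A \in T i -> (conn (S i) A <= K)%N.
Hypothesis linkT : forall i, linked_family (conn (S i)) (T i).

Let node := {i : nat & {A : {set G i} | A \in T i}}.
Let mk i (A : {set G i}) (h : A \in T i) : node := Tagged _ (exist _ A h : {A : {set G i} | A
  \in T i}).
Let nset (a : node) : {set G (tag a)} := val (tagged a).
Let nsetT (a : node) : nset a \in T (tag a) := valP (tagged a).
Let lev a := conn (S (tag a)) (nset a).

Let lag i : lagrangian (cg_form (N i)) (S i) := lagN i.

Let spl (a b c : node) := exists (B C : {set G (tag a)}) (hB : B \in T (tag a)) (hC : C \in T
  (tag a)),
  [/\ b = mk hB, c = mk hC, B :|: C = nset a & [disjoint B & C]].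

Lemma exists_node_coloring : exists col : forall i, {set G i} -> chain F (G i) -> Col,
  forall i A, A \in T i -> proper_coloring (S i) A (@col i A).
Proof.
have H (x : {i : nat & {set G i}}) : exists c : chain F (G (tag x)) -> Col,
    tagged x \in T (tag x) -> proper_coloring (S (tag x)) (tagged x) c.
  case: x => i A /=; have [AT|nAT] := boolP (A \in T i); last by exists (fun _ => 0).
  by have [c hc] := exists_proper_coloring (lag i) (connK AT); exists c.
have [col hcol] := dep_choice H; exists (fun i A => col (Tagged (fun i => {set G i}) A)) => i A.
exact: (hcol (Tagged (fun i => {set G i}) A)).
Qed.

Lemma wqo_nodes : exists p : node -> piece Q F K,
  (forall i (h : [set: G i] \in T i), exists2 c, proper_coloring (S i) setT c &
     p (mk h) = Piece (S i) (@lcg_label _ _ (N i)) setT c) /\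
  wqo_on (fun a b => exists pi, piece_le le pi (p a) (p b)) (fun _ => True).
Proof.
have [refl tr wq] := wqoQ.
have [col hcol] := exists_node_coloring.
pose p (a : node) := Piece (S (tag a)) (@lcg_label _ _ (N (tag a))) (nset a) (@col (tag a)
  (nset a)).
exists p; split; first by move=> i h; exists (@col i setT) => //; apply: hcol.
have ple_trans pi rho a b c : piece_le le pi (p a) (p b) -> piece_le le rho (p b) (p c) ->
    piece_le le (pi * rho)%g (p a) (p c) by apply: piece_le_trans.
have trN x y z : (exists pi, piece_le le pi (p x) (p y)) -> (exists pi, piece_le le pi (p y) (p
  z)) ->
    exists pi, piece_le le pi (p x) (p z).
  by move=> [pi h1] [rho h2]; exists (pi * rho)%g; apply: ple_trans h1 h2.
pose L (a : node) := exists x, nset a = [set x].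
have wL : wqo_on (fun a b => exists pi, piece_le le pi (p a) (p b)) L.
  move=> s Ls.
  have [x hx] : exists x : forall n, G (tag (s n)), forall n, nset (s n) = [set x n].
    exact: (dep_choice (R := fun n x => nset (s n) = [set x])).
  (* Make the point type constant along a subsequence; only the labels remain to be compared. *)
  have [phi hphi ch] := @wqo_chain _ _ _ (fun n => point_type (p := p (s n)) (x n))
     (fun x y z => @etrans _ x y z) (@wqo_finType _) (fun _ => Logic.I).
  have [i [j [ij h]]] := wq (fun n => lcg_label (x (phi n))).
  exists (phi i), (phi j); split; first exact: hphi.
  exists 1%g; apply: (@piece_le_point _ _ _ _ (p (s (phi i))) (p (s (phi j))) (x (phi i)) (x
    (phi j))).
  - exact: hx.
  - exact: hx.
  - exact: ch.
  exact: h.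
(* By laminarity the nodes between [B] and [nset a] are those of the path, so all of them but [B]
   are known to have level at least [j]. *)
have path_sets j a b : high_path lev spl j a b -> exists B (hB : B \in T (tag a)),
    [/\ b = mk hB, B \subset nset a & forall Y, Y \in T (tag a) -> B \subset Y -> Y \subset
      nset a ->
       Y = B \/ (j <= conn (S (tag a)) Y)%N].
  have step (a' : node) (B C D : {set G (tag a')}) : B \in T (tag a') -> C \in T (tag a') -> D
    \in T (tag a') ->
      (j <= conn (S (tag a')) B)%N -> C :|: D = B -> [disjoint C & D] -> B \subset nset a' ->
      (forall Y, Y \in T (tag a') -> B \subset Y -> Y \subset nset a' -> Y = B \/ (j <= conn (S
        (tag a')) Y)%N) ->
      C \subset nset a' /\ forall Y, Y \in T (tag a') -> C \subset Y -> Y \subset nset a' ->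
        Y = C \/ (j <= conn (S (tag a')) Y)%N.
    move=> BT CT DT jB E d Ba H; have [_ n0 lam _] := treeT (tag a').
    have CB : C \subset B by rewrite -E subsetUl.
    split; first exact: subset_trans Ba.
    move=> Y YT CY Ya.
    have nd (X : {set G (tag a')}) : C \subset X -> ~ [disjoint C & X].
      move=> CX dX; have : C == set0 by rewrite -[C]setIid setI_eq0 (disjointWr CX).
      by move/eqP => C0; rewrite -C0 CT in n0.
    case: (lam Y B YT BT) => [YB|[BY|dYB]].
    - case: (lam Y D YT DT) => [YD|[DY|dYD]].
      + by case: (nd D) => //; apply: subset_trans YD.
      + right; suff -> : Y = B by [].
        by apply/eqP; rewrite eqEsubset YB -E subUset CY.
      left; apply/eqP; rewrite eqEsubset CY andbT; apply/subsetP => y yY.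
      by have := subsetP YB y yY; rewrite -E inE (disjointFr dYD yY) orbF.
    - by case: (H Y YT BY Ya) => [->|]; right.
    by case: (nd B CB); rewrite disjoint_sym; apply: disjointWr CY _; rewrite disjoint_sym.
  elim=> {a b} [a|a b c d _ [B [hB [-> Ba H]]] jb [C [D [hC [hD [-> _ E dCD]]]]]|a b c d _ [B
    [hB [-> Ba H]]] jb [D [C [hD [hC [_ -> E dCD]]]]]].
  - exists (nset a), (nsetT a); split=> //.
      by rewrite /mk; case: a => i [A hA]; congr Tagged; apply: val_inj.
    by move=> Y _ h1 h2; left; apply/eqP; rewrite eqEsubset h1 h2.
  - have [h1 h2] := step a B C D hB hC hD jb E dCD Ba H.
    by exists C, hC.
  rewrite setUC disjoint_sym in E dCD.
  have [h1 h2] := step a B C D hB hC hD jb E dCD Ba H.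
  by exists C, hC.
have linked j a b : high_path lev spl j a b -> lev a = j -> lev b = j ->
    exists pi, piece_le le pi (p b) (p a).
  move=> hp la lb; have [B [hB [Eb Ba HY]]] := path_sets _ _ _ hp; subst b.
  have lB : conn (S (tag a)) B = j := lb.
  apply: (@piece_le_linked Q le F K refl (cg_form (N (tag a))) _ (S (tag a))
    (@lcg_label _ _ (N (tag a))) (nset a) B (@col _ (nset a)) (@col _ B)) => //.
  - by apply: hcol; apply: nsetT.
  - exact: hcol.
  - by rewrite lB.
  (* Linkedness carries the lower bound from the nodes over to arbitrary sets between [B] and
     [nset a]. *)
  move=> Z BZ Za; have [Y YT [BY Ya YZ]] := linkT (nsetT a) hB BZ Za.
  apply: leq_trans YZ; rewrite lB; by case: (HY Y YT BY Ya) => [->|//]; rewrite lB.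
have splg W a b c : wqo_on (fun a b => exists pi, piece_le le pi (p a) (p b)) W ->
    (forall n, spl (a n) (b n) (c n)) -> (forall n, W (b n)) -> (forall n, W (c n)) ->
    good (fun a b => exists pi, piece_le le pi (p a) (p b)) a.
  move=> wW hs Wb Wc.
  have wI : wqo_on (fun a b => piece_le le 1%g (p a) (p b)) W.
    exact: (wqo_group_trivial (r := fun g a b => piece_le le g (p a) (p b))) wW.
  have trI x y z : piece_le le 1%g (p x) (p y) -> piece_le le 1%g (p y) (p z) -> piece_le le
    1%g (p x) (p z).
    by move=> h1 h2; have := ple_trans _ _ _ _ _ h1 h2; rewrite mulg1.
  (* Successive subsequences make the first children increase, then the second ones; finally two
     gluings coincide. *)
  have [f1 mf1 c1] := wqo_chain trI wI Wb.
  have [f2 mf2 c2] := @wqo_chain _ _ _ (c \o f1) trI wI (fun n => Wc _).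
  pose f n := f1 (f2 n).
  have hg n : exists B C, [/\ exists (hB : B \in T (tag (a (f n)))) (hC : C \in T (tag (a (f
    n)))), b (f n) = mk hB /\ c (f n) = mk hC, B :|: C = nset (a (f n)) & [disjoint B & C]].
    by have [B [C [hB [hC [e1 e2 e3 e4]]]]] := hs (f n); exists B, C; split=> //; exists hB, hC.
  have [B hB] := dep_choice hg.
  have [C hC] := dep_choice hB.
  pose gl n := gluing (S (tag (a (f n)))) (@col _ (B n)) (@col _ (C n)) (@col _ (nset (a (f n)))).
  have [i [j [ij eg]]] := @wqo_finType _ gl (fun _ => Logic.I).
  exists (f i), (f j); split; first by apply: mf1; apply: mf2.
  exists 1%g.
  have [[hBi [hCi [bi ci]]] ui di] := hC i; have [[hBj [hCj [bj cj]]] uj dj] := hC j.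
  have := c1 (f2 i) (f2 j) (mf2 _ _ ij); rewrite -/(f i) -/(f j) bi bj => leB.
  have := c2 i j ij; rewrite /= -/(f i) -/(f j) ci cj => leC.
  have okA n := hcol _ _ (nsetT (a (f n))).
  move: eg okA; rewrite /gl /p => eg okA.
  have := okA i; have := okA j; move: eg; rewrite -ui -uj => eg okj oki.
  exact: piece_le_glue dj di (hcol _ _ hBj) (hcol _ _ hCj) okj (hcol _ _ hBi) (hcol _ _ hCi)
    oki eg leB leC.
have spl_lt (a : node) (B C : {set G (tag a)}) : B \in T (tag a) -> C \in T (tag a) ->
    B :|: C = nset a -> [disjoint B & C] -> (#|B| < #|nset a|)%N /\ (#|C| < #|nset a|)%N.
  move=> BT CT <-; rewrite -setI_eq0 => /eqP d; have [_ n0 _ _] := treeT (tag a).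
  rewrite cardsU d cards0 subn0 -{1}[#|B|]addn0 -{2}[#|C|]add0n ltn_add2l ltn_add2r !card_gt0.
  by split; apply: contraNneq n0 => <-.
have all_trunk a : trunk lev spl 0 L a.
  have [n] := ubnP #|nset a|; elim: n a => // n IH a an.
  have [_ _ _ /(_ _ (nsetT a))[c1|[B [C [hB hC E d]]]]] := treeT (tag a).
    by apply: Trunk_leaf; apply/cards1P; rewrite c1.
  have [lB lC] := spl_lt a B C hB hC E d.
  apply: (@Trunk_node _ _ _ _ _ _ (mk hB) (mk hC)) => //.
  - by exists B, C, hB, hC.
  - by apply: IH; apply: leq_trans lB an.
  by apply: IH; apply: leq_trans lC an.
apply: (@wqo_on_sub _ _ _ (trunk lev spl 0 L)) => //.
apply: (@wqo_trunk _ _ (fun a => #|nset a|) lev K spl trN _ _ linked splg 0 L wL).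
- by move=> a; apply: connK; apply: nsetT.
by move=> a b c [B [C [hB [hC [-> -> E d]]]]]; apply: (spl_lt a B C).
Qed.

Lemma exists_embedding : exists i j, (i < j)%N /\
  exists (mu : G i -> G j) (b : G j -> 'I_2),
  [/\ injective mu, forall x, le (lcg_label x) (lcg_label (mu x)) &
    forall h, h \in S i <-> exists f, [/\ f \in S j,
     forall x, f (mu x) = h x & forall y, y \notin codom mu -> f y (b y) 0 = 0]].
Proof.
have [p [hp wp]] := wqo_nodes.
have hT i : [set: G i] \in T i by case: (treeT i).
have [i [j [ij [pi]]]] := wp (fun i => mk (hT i)) (fun _ => Logic.I).
have [ci oki ->] := hp i (hT i); have [cj okj ->] := hp j (hT j).
move=> [mu [b [/= inj lab H]]]; exists i, j; split=> //; exists mu, b.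
have projT (V : finType) (f : chain F V) : proj setT f = f by apply/ffunP => x; rewrite ffunE inE.
(* At a root all chains have the same color, so that [realizes] reduces to membership. *)
have consti f g : f \in S i -> g \in S i -> ci f = ci g by move=> fN gN; apply/(oki _ _ fN gN);
  rewrite projT memvB.
have constj f g : f \in S j -> g \in S j -> cj f = cj g by move=> fN gN; apply/(okj _ _ fN gN);
  rewrite projT memvB.
have E : cj 0 = pi (ci 0).
  have /H[f [fN fc _ _]] : realizes (p := Piece (S i) (@lcg_label _ _ (N i)) setT ci) 0 (ci 0).
    by exists 0; split; rewrite ?mem0v.
  by rewrite -fc; apply: constj; rewrite ?mem0v.
have imE : mu @: setT =i codom mu.
  by move=> y; apply/imsetP/codomP => [[x _ ->]|[x ->]]; exists x.
split.
- by move=> x y; apply: inj.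
- by move=> x; case: (lab x).
move=> h; split=> [hN|[f [fN fh fb]]].
  have /H[f [fN _ fh fb]] : realizes (p := Piece (S i) (@lcg_label _ _ (N i)) setT ci) h (ci 0).
    by exists h; split=> //=; apply: consti; rewrite ?mem0v.
  by exists f; split=> // [x|y yn]; [apply: fh | apply: fb; rewrite // imE].
have [|g [/= gN _ gh]] := (H h (ci 0)).2.
  exists f; split=> //; first by rewrite -E; apply: constj; rewrite ?mem0v.
  by move=> y _; rewrite imE; apply: fb.
by rewrite (_ : h = g) //; apply/ffunP => x; rewrite gh.
Qed.
End Assembly.

Lemma exists_linked_tree_family (F : finFieldType) (N : chain_group F) (k : rat) (K : nat) :
  Lagrangian N -> branch_width_at_most N k -> k <= K%:R -> (0 < #|cg_ground N|)%N ->
  exists T, [/\ tree_family T, forall X, X \in T -> (conn (cg_space N) X <= K)%N &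
    linked_family (conn (cg_space N)) T].
Proof.
move=> lagN [w bw wk] kK V0; have lag : lagrangian (cg_form N) (cg_space N) := lagN.
suff /decomposable_tree_family[T treeT TK] : decomposable (conn (cg_space N)) K setT.
  exact: (linked_tree_family (connC lag) (conn_submod lag) treeT TK).
(* On one element the branch-width is 0 by convention and provides no decomposition. *)
have [V1|V1] := leqP #|cg_ground N| 1.
  have /cards1P[x Ex] : #|[set: cg_ground N]| == 1%N by rewrite cardsT eqn_leq V1.
  by rewrite Ex; apply: Decomposable1; rewrite -Ex (conn_setT lag).
move: bw; rewrite /is_branch_width leqNgt V1 => -[[D ED] _].
apply: (@bd_decomposable _ D) => //; last by rewrite (conn_setT lag).
move=> t t' tt'; rewrite -(ler_nat rat) -connectivityE //.
apply: le_trans (le_trans wk kK); rewrite -ED.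
exact: (@le_bigmax_cond _ _ _ _ (t, t') (fun p : bd_vertex D * bd_vertex D => bd_adj p.1 p.2)
  (fun p => connectivity (bd_side p.1 p.2))).
Qed.

Theorem theorem6p1 (Q : Type) (le : Q -> Q -> Prop) (k : rat)
    (F : finFieldType) (N : nat -> labeled_chain_group F Q)
    (wqoQ : well_quasi_order le)
    (lagN : forall i, Lagrangian (N i))
    (bwN : forall i, branch_width_at_most (N i) k) :
  exists i j : nat, (i < j)%N /\
    exists M : labeled_chain_group F Q,
      Q_minor le (N j) M /\ labeled_simply_isomorphic (N i) M.
Proof.
(* Minors keep the form, so it must agree at [i] and [j]; and an empty ground set has no tree
   family, whose root must be nonempty. Both data are made constant along a subsequence. *)
pose kind i := (if cg_form (N i) is Symmetric then true else false, #|cg_ground (N i)| == 0%N).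
have [phi mphi ckind] := @wqo_chain _ _ _ kind (fun x y z => @etrans _ x y z)
  (@wqo_finType _) (fun _ => Logic.I).
have eqf i j : (i < j)%N -> cg_form (N (phi i)) = cg_form (N (phi j)).
  by move=> /ckind[]; case: (cg_form (N (phi i))); case: (cg_form (N (phi j))).
have [/eqP V0|V0] := boolP (#|cg_ground (N (phi 0%N))| == 0%N).
  have V1 : #|cg_ground (N (phi 1%N))| = 0%N by case: (ckind 0%N 1%N isT) => _; rewrite V0 =>
    /esym/eqP.
  have no0 (x : cg_ground (N (phi 0%N))) : False by have := card0_eq V0 x; rewrite inE.
  have no1 (x : cg_ground (N (phi 1%N))) : False by have := card0_eq V1 x; rewrite inE.
  exists (phi 0%N), (phi 1%N); split; first exact: mphi.
  apply: (@Q_minor_of_embedding _ _ _ _ _ (fun x => False_rect _ (no0 x)) (fun _ => 0)).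
  - exact: eqf.
  - by move=> x; case: (no0 x).
  - by move=> x; case: (no0 x).
  move=> h; split=> _; last by rewrite (_ : h = 0) ?mem0v //; apply/ffunP => x; case: (no0 x).
  by exists 0; split=> [|x|y]; [rewrite mem0v | case: (no0 x) | case: (no1 y)].
have Vpos i : (0 < #|cg_ground (N (phi i))|)%N.
  rewrite lt0n; case: i => [//|i]; apply: contra V0 => E.
  by case: (ckind 0%N i.+1 isT) => _; rewrite E => ->.
have [K kK] : exists K : nat, k <= K%:R.
  by exists (Num.bound `|k|); apply: ltW; apply: le_lt_trans (ler_norm k) _; apply: archi_boundP.
have HT i := exists_linked_tree_family (lagN (phi i)) (bwN (phi i)) kK (Vpos i).
have [T hT] := dep_choice HT.
have [i [j [ij [mu [b [inj lab H]]]]]] : exists i j, (i < j)%N /\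
    exists (mu : cg_ground (N (phi i)) -> cg_ground (N (phi j))) (b : cg_ground (N (phi j)) ->
      'I_2),
    [/\ injective mu, forall x, le (lcg_label x) (lcg_label (mu x)) &
    forall h, h \in cg_space (N (phi i)) <-> exists f, [/\ f \in cg_space (N (phi j)),
     forall x, f (mu x) = h x & forall y, y \notin codom mu -> f y (b y) 0 = 0]].
  apply: (@exists_embedding Q le F K wqoQ (fun i => N (phi i)) (fun i => lagN (phi i)) T).
  - by move=> i; case: (hT i).
  - by move=> i; case: (hT i).
  by move=> i; case: (hT i).
exists (phi i), (phi j); split; first exact: mphi.
exact: Q_minor_of_embedding (eqf _ _ ij) inj lab H.
Qed.
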